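(* Let $0\le\beta<1$. For each $N$ let $N_1=N_1(N)$ and $N_2=N_2(N)$ be positive integers with $N_1+N_2\le N$ such that $N_1\to\infty$ and $N_2\to\infty$ as $N\to\infty$, and assume that the limits $$\alpha_1=\lim_{N\to\infty}\frac{N_1}{N},\qquad \alpha_2=\lim_{N\to\infty}\frac{N_2}{N}$$ exist. Let $X_1,\dots,X_{N_1}$ and $Y_1,\dots,Y_{N_2}$ be two disjoint groups of spins chosen out of the $N$ spins of the Curie-Weiss model with $N$ spins at inverse temperature $\beta$. Then the random vectors $$\Big(\frac{1}{\sqrt{N_1}}\sum_{i=1}^{N_1}X_i,\ \frac{1}{\sqrt{N_2}}\sum_{j=1}^{N_2}Y_j\Big)$$ converge in distribution, as $N\to\infty$, to the bivariate normal distribution $\mathcal{N}((0,0),C)$ with covariance matrix $$C=\begin{pmatrix}1+\alpha_1\frac{\beta}{1-\beta} & \sqrt{\alpha_1\alpha_2}\,\frac{\beta}{1-\beta}\\ \sqrt{\alpha_1\alpha_2}\,\frac{\beta}{1-\beta} & 1+\alpha_2\frac{\beta}{1-\beta}\end{pmatrix}.$$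
   Context: The Curie-Weiss model with $N$ spins at inverse temperature $\beta\ge 0$ is the probability measure on $\{-1,1\}^N$ given by $\mathbb{P}(x_1,\dots,x_N)=Z^{-1}\exp\big(\frac{\beta}{2N}(\sum_{j=1}^N x_j)^2\big)$, where $Z=Z(N,\beta)$ is the normalizing constant; the spins are the coordinate random variables. *)

(* Defs.v *)
From HB Require Import structures.
From mathcomp Require Import all_boot all_order all_algebra.
From mathcomp Require Import ring.
From mathcomp Require Import all_classical all_reals all_analysis.
From mathcomp Require Import measurable_realfun.

Set Implicit Arguments.
Unset Strict Implicit.
Unset Printing Implicit Defensive.

Import Order.TTheory GRing.Theory Num.Theory.
Import numFieldNormedType.Exports.

Local Open Scope classical_set_scope.
Local Open Scope ring_scope.

(* A configuration x : spins N encodes an element of {-1, 1}^N: the i-th spin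
   is +1 if x i is true and -1 otherwise. *)
Definition spins (N : nat) : Type := {ffun 'I_N -> bool}.

HB.instance Definition _ N := Finite.on (spins N).
HB.instance Definition _ N := isPointed.Build (spins N) [ffun => false].
HB.instance Definition _ N := @isMeasurable.Build default_measure_display
  (spins N) discrete_measurable discrete_measurable0
  discrete_measurableC discrete_measurableU.

Definition spin (R : realType) (N : nat) (i : 'I_N) (x : spins N) : R :=
  if x i then 1 else -1.

Section curie_weiss.
Context {R : realType}.
Variables (N : nat) (beta : R).

Definition cw_weight (x : spins N) : R :=
  expR (beta / (2 * N%:R) * (\sum_(i < N) spin R i x) ^+ 2).

Definition cw_Z : R := \sum_(x : spins N) cw_weight x.

Definition cw_pmf (x : spins N) : R := cw_Z^-1 * cw_weight x.

Definition curie_weiss (A : set (spins N)) : \bar R :=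
  (\sum_(x \in A) (cw_pmf x)%:E)%E.

Lemma cw_Z_gt0 : 0 < cw_Z.
Proof.
rewrite /cw_Z (bigD1 (point : spins N))//= ltr_wpDr ?expR_gt0//.
by apply: sumr_ge0 => x _; exact: expR_ge0.
Qed.

Lemma cw_pmf_ge0 x : 0 <= cw_pmf x.
Proof. by rewrite mulr_ge0 ?expR_ge0// invr_ge0 ltW// cw_Z_gt0. Qed.

Let curie_weiss0 : curie_weiss set0 = 0%E.
Proof. by rewrite /curie_weiss fsbig_set0. Qed.

Let curie_weiss_ge0 A : (0 <= curie_weiss A)%E.
Proof.
rewrite /curie_weiss fsbig_finite//= sumEFin lee_fin.
by apply: sumr_ge0 => /= x _; exact: cw_pmf_ge0.
Qed.

Let curie_weiss_sigma_additive : semi_sigma_additive curie_weiss.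
Proof.
move=> F mF tF mUF; apply: cvg_toP.
  apply: ereal_nondecreasing_is_cvgn => m n mn.
  by apply: lee_sum_nneg_natr => // k _ _; exact: curie_weiss_ge0.
transitivity (\sum_(0 <= i <oo) (\esum_(j in F i) (cw_pmf j)%:E))%E.
  apply: eq_eseriesr => k _; rewrite esum_fset//= => b _.
  by rewrite lee_fin cw_pmf_ge0.
rewrite -nneseries_sum_bigcup//=; last first.
  by move=> b; rewrite lee_fin cw_pmf_ge0.
by rewrite esum_fset//= => b _; rewrite lee_fin cw_pmf_ge0.
Qed.

HB.instance Definition _ := isMeasure.Build _ _ _ curie_weiss
  curie_weiss0 curie_weiss_ge0 curie_weiss_sigma_additive.

Let curie_weiss_setT : curie_weiss [set: _] = 1%E.
Proof.
rewrite /curie_weiss.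
have -> : [set: spins N] = [set` index_enum (spins N)].
  by apply/seteqP; split => // x _ /=; rewrite mem_index_enum.
rewrite -fsbig_seq ?index_enum_uniq// sumEFin -mulr_sumr.
by rewrite mulVf// gt_eqF// cw_Z_gt0.
Qed.

HB.instance Definition _ :=
  @Measure_isProbability.Build _ _ R curie_weiss curie_weiss_setT.

End curie_weiss.

Arguments curie_weiss {R} N beta A.

Section normalized_sums.
Context {R : realType}.
Variables (N : nat) (A B : {set 'I_N}).

Definition normalized_sum (S : {set 'I_N}) (x : spins N) : R :=
  (Num.sqrt #|S|%:R)^-1 * \sum_(i in S) spin R i x.

Definition normalized_sums (x : spins N) : R * R :=
  (normalized_sum A x, normalized_sum B x).

Let measurable_normalized_sums : measurable_fun [set: spins N] normalized_sums.
Proof. by []. Qed.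

HB.instance Definition _ :=
  isMeasurableFun.Build _ _ _ _ normalized_sums measurable_normalized_sums.

End normalized_sums.

(* The limit is allowed to be any measure because bivariate_normal m C is a
   probability measure only when C is positive definite; taking f = 1 shows
   that a weak limit has mass 1. *)
Definition weak_cvg (R : realType) (mu_ : nat -> probability (R * R)%type R)
    (mu : {measure set (R * R) -> \bar R}) :=
  forall f : R * R -> R, continuous f -> bounded_fun f ->
  (\int[mu_ n]_z (f z)%:E)%E @[n --> \oo] --> (\int[mu]_z (f z)%:E)%E.

Definition cvg_in_distribution (R : realType) (d : measure_display)
    (T : nat -> measurableType d) (P : forall n, probability (T n) R)
    (X : forall n, {RV (P n) >-> (R * R)%type})
    (mu : {measure set (R * R) -> \bar R}) :=
  weak_cvg (fun n => distribution (P n) (X n)) mu.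

Arguments cvg_in_distribution {R d T} P X mu.

Definition mx2 (R : Type) (a b c d : R) : 'M[R]_2 :=
  \matrix_(i, j) if i == 0 then (if j == 0 then a else b)
                 else (if j == 0 then c else d).

Definition row2 (R : Type) (z : R * R) : 'rV[R]_2 :=
  \row_j if j == 0 then z.1 else z.2.

Section bivariate_normal.
Context {R : realType}.
Variables (m : R * R) (C : 'M[R]_2).

(* The density of N(m, C) for positive definite C; see bivariate_normal_setT
   for the fact that bivariate_normal is then a probability measure. For other
   C these definitions are junk. *)
Definition bivariate_normal_pdf (z : R * R) : R :=
  (2 * pi * Num.sqrt (\det C))^-1 *
  expR (- (row2 (z - m) *m invmx C *m (row2 (z - m))^T) 0 0 / 2).

Definition bivariate_normal (A : set (R * R)) : \bar R :=
  (\int[lebesgue_measure \x lebesgue_measure]_(z in A)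
     (bivariate_normal_pdf z)%:E)%E.

Lemma bivariate_normal_pdf_ge0 z : 0 <= bivariate_normal_pdf z.
Proof.
by rewrite mulr_ge0 ?expR_ge0// invr_ge0 !mulr_ge0 ?sqrtr_ge0// pi_ge0.
Qed.

Let quad (z : R * R) : R :=
  (row2 (z - m) *m invmx C *m (row2 (z - m))^T) 0 0.

Let sum_ord2 (F : 'I_2 -> R) : \sum_(i < 2) F i = F 0 + F 1.
Proof.
rewrite big_ord_recl big_ord1; congr (_ + F _); exact/val_inj.
Qed.

Let quadE z : quad z =
  (z.1 - m.1) ^+ 2 * invmx C 0 0 +
  (z.1 - m.1) * (z.2 - m.2) * (invmx C 0 1 + invmx C 1 0) +
  (z.2 - m.2) ^+ 2 * invmx C 1 1.
Proof.
rewrite /quad mxE sum_ord2 !mxE /= !sum_ord2 !mxE /=.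
ring.
Qed.

Lemma measurable_bivariate_normal_pdf :
  measurable_fun [set: R * R] bivariate_normal_pdf.
Proof.
have m1 : measurable_fun [set: R * R] (fun z : R * R => z.1 - m.1).
  by apply: measurable_funB => //; exact: measurable_fst.
have m2 : measurable_fun [set: R * R] (fun z : R * R => z.2 - m.2).
  by apply: measurable_funB => //; exact: measurable_snd.
apply: measurable_funM => //; apply: measurableT_comp => //=.
apply: measurable_funM => //; apply: measurableT_comp => //.
rewrite (_ : (fun _ => _) = quad)//; rewrite (funext quadE).
apply: measurable_funD; last first.
  by apply: measurable_funM => //; exact: measurable_funX.
apply: measurable_funD; apply: measurable_funM => //.
  exact: measurable_funX.
exact: measurable_funM.
Qed.

Let bivariate_normal0 : bivariate_normal set0 = 0%E.
Proof. by rewrite /bivariate_normal integral_set0. Qed.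

Let bivariate_normal_ge0 A : (0 <= bivariate_normal A)%E.
Proof.
by apply: integral_ge0 => z _; rewrite lee_fin bivariate_normal_pdf_ge0.
Qed.

Let bivariate_normal_sigma_additive : semi_sigma_additive bivariate_normal.
Proof.
move=> F mF tF mUF; rewrite /bivariate_normal.
rewrite ge0_integral_bigcup//=; last 2 first.
- apply: measurable_funTS; apply/measurable_EFinP.
  exact: measurable_bivariate_normal_pdf.
- by move=> z _; rewrite lee_fin bivariate_normal_pdf_ge0.
apply: is_cvg_ereal_nneg_natsum_cond => n _ _; exact: bivariate_normal_ge0.
Qed.

HB.instance Definition _ := isMeasure.Build _ _ _ bivariate_normal
  bivariate_normal0 bivariate_normal_ge0 bivariate_normal_sigma_additive.

(* The hypotheses say that C is symmetric positive definite (Sylvester). *)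
Lemma bivariate_normal_setT : C 0 1 = C 1 0 -> 0 < C 0 0 -> 0 < \det C ->
  bivariate_normal [set: R * R] = 1%E.
Proof.
have [a aE] : {a | C 0 0 = a} by exists (C 0 0).
have [b bE] : {b | C 1 0 = b} by exists (C 1 0).
have [c cE] : {c | C 1 1 = c} by exists (C 1 1).
have [D detE] : {D | \det C = D} by exists (\det C).
rewrite aE bE detE => Csym a_gt0 D_gt0.
have DE : D = a * c - b ^+ 2.
  rewrite -detE (expand_det_row _ 0) sum_ord2 /cofactor !det_mx11 !mxE.
  rewrite (_ : lift 0 0 = 1); last exact/val_inj.
  rewrite (_ : lift 1 0 = 0); last exact/val_inj.
  by rewrite aE bE cE Csym /= expr0 expr1; ring.
have a0 : a != 0 by rewrite gt_eqF.
have D0 : D != 0 by rewrite gt_eqF.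
have ord2P (i : 'I_2) : i = 0 \/ i = 1.
  by case: i => [[|[|//]] i2]; [left|right]; exact/val_inj.
pose M : 'M[R]_2 := mx2 (c / D) (- b / D) (- b / D) (a / D).
have CM : C *m M = 1%:M.
  apply/matrixP => i j; rewrite !mxE sum_ord2 !mxE.
  by case: (ord2P i) => ->; case: (ord2P j) => ->;
    rewrite /= ?aE ?bE ?cE ?Csym ?mulr1n ?mulr0n;
    move: D0; rewrite DE => D0; field.
have CVE : invmx C = M.
  by rewrite -[LHS]mulmx1 -CM mulKmx// unitmxE unitfE detE.
have sDa_gt0 : 0 < D / a by rewrite divr_gt0.
pose s1 := Num.sqrt a; pose s2 := Num.sqrt (D / a).
have s1_neq0 : s1 != 0 by rewrite gt_eqF// sqrtr_gt0.
have s2_neq0 : s2 != 0 by rewrite gt_eqF// sqrtr_gt0.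
pose m2 x := m.2 + b / a * (x - m.1).
have pdfE z : bivariate_normal_pdf z =
    normal_pdf m.1 s1 z.1 * normal_pdf (m2 z.1) s2 z.2.
  rewrite /bivariate_normal_pdf detE -/(quad z) !normal_pdfE//.
  rewrite /normal_peak /normal_fun mulrACA -invfM -expRD.
  rewrite /s1 /s2 !sqr_sqrtr ?ltW//; congr (_^-1 * expR _).
    rewrite -sqrtrM; last by rewrite mulrn_wge0// mulr_ge0 ?pi_ge0// ltW.
    rewrite (_ : a * pi *+ 2 * _ = (2 * pi) ^+ 2 * D).
      by rewrite sqrtrM ?sqr_ge0// sqrtr_sqr ger0_norm// mulr_ge0// pi_ge0.
    by field.
  rewrite quadE CVE !mxE /= /m2.
  move: D0; rewrite DE => D0; field.
  by rewrite a0 D0.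
rewrite /bivariate_normal fubini_tonelli1/=; last 2 first.
- apply/measurable_EFinP; exact: measurable_bivariate_normal_pdf.
- by move=> z; rewrite lee_fin bivariate_normal_pdf_ge0.
rewrite /fubini_F -(integral_normal_pdf m.1 s1); apply: eq_integral => x _.
under eq_integral do rewrite pdfE/= EFinM.
rewrite ge0_integralZl//=; last 3 first.
- by apply/measurable_EFinP; exact: measurable_normal_pdf.
- by move=> y _; rewrite lee_fin normal_pdf_ge0.
- by rewrite lee_fin normal_pdf_ge0.
by rewrite integral_normal_pdf mule1.
Qed.

End bivariate_normal.

(* Main.v *)
(* Write [sigma_A], [sigma_B], [sigma_C] for the sums of the spins in A, in B and in the
   remaining [c] sites. Counting configurations by the numbers of + spins in A and B,
   the expectation of [f] is a ratio [T f / T 1], where [T f] is a double sum of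
   [f] against [C(n,k) C(m,l) W(sigma_A + sigma_B)] and [W] collects the third group:
   the average of [expR (tau^2 (s + sigma_C)^2 / 2)], [tau^2 = beta / N].
   - By Hubbard-Stratonovich, [W(s)] is a Gaussian average over [z] of
     [expR (tau s z) cosh(tau z)^c]; the inequalities [1 + t^2/2 <= cosh t <= expR (t^2/2)] give
     its limit and a bound by [expR (beta (u^2 + v^2) / 2)], [u] and [v] being the normalised
     sums over A and B.
   - [C(n,k) / C(n,n/2)] is a product of factors [(1-y)/(1+y)], hence tends to [expR (- x^2/2)]
     and is at most [expR (1/2 - u^2/2 * n/(n+1))]. This is sharp enough to beat the
     factor [expR (beta u^2 / 2)] for every [beta < 1].
   Viewing [T f] as the integral of a step function on the plane, dominated convergence
   gives its limit; taking ratios to [f = 1] makes all normalising constants irrelevant. *)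
Require Import Defs.
From HB Require Import structures.
From mathcomp Require Import all_boot all_order all_algebra.
From mathcomp Require Import ring lra zify.
From mathcomp Require Import all_classical all_reals all_analysis.
From mathcomp Require Import measurable_realfun.

Set Implicit Arguments.
Unset Strict Implicit.
Unset Printing Implicit Defensive.

Import Order.TTheory GRing.Theory Num.Theory.
Import numFieldNormedType.Exports.

Local Open Scope classical_set_scope.
Local Open Scope ring_scope.

(** * Bounds on the exponential *)

Section exponential_bounds.
Context {R : realType}.
Implicit Types x y t : R.

Lemma ge0_derive_homo (g dg : R -> R) x :
  (forall y, is_derive y 1 g (dg y)) -> (forall y, 0 <= y -> 0 <= dg y) ->
  0 <= x -> g 0 <= g x.
Proof.
move=> gdg dg0 x0.
have dgP y : derivable g y 1 by have [] := gdg y.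
apply: (@ger0_derive1_le_cc _ g 0 x) => //.
- by move=> y; rewrite in_itv/= => /andP[y0 _]; rewrite derive1E derive_val dg0// ltW.
- by apply: derivable_within_continuous => y _; exact: dgP.
- by rewrite in_itv/= lexx.
- by rewrite in_itv/= lexx x0.
Qed.

(** This is [cosh t - 1 = 2 sinh(t/2)^2]. It makes the derivative in the next lemma a square and
    later gives the lower bound on [cosh]. *)
Lemma sqr_expRBexpRN t :
  (expR (t / 2) - expR (- (t / 2))) ^+ 2 = expR t + expR (- t) - 2.
Proof.
have tE : t = t / 2 + t / 2 by field.
have uv : expR (t / 2) * expR (- (t / 2)) = 1 by rewrite -expRD subrr expR0.
rewrite [in RHS]tE opprD !expRD; lra.
Qed.

Lemma double_le_expRBexpRN y : 0 <= y -> 2 * y <= expR y - expR (- y).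
Proof.
move=> y0; rewrite -subr_ge0.
pose g z : R := expR z - expR (- z) - 2 * z.
have -> : 0 = g 0 by rewrite /g oppr0 subrr mulr0 subr0.
apply: (@ge0_derive_homo g (fun z => (expR (z / 2) - expR (- (z / 2))) ^+ 2)) => // z.
- by rewrite sqr_expRBexpRN; apply: is_derive_eq; rewrite /GRing.scale/=; ring.
- by move=> _; exact: sqr_ge0.
Qed.

(** Half the difference of the sides is [y cosh y - sinh y], so this is [tanh y <= y]. It drives the
    upper bounds on [cosh] and on [(1 - y) / (1 + y)]. *)
Lemma expRM1B_le y : 0 <= y -> expR y * (1 - y) <= expR (- y) * (1 + y).
Proof.
move=> y0; rewrite -subr_ge0.
pose g z : R := expR (- z) * (1 + z) - expR z * (1 - z).
have -> : 0 = g 0 by rewrite /g !(oppr0,addr0,subr0) subrr.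
apply: (@ge0_derive_homo g (fun z => z * (expR z - expR (- z)))) => // z.
- by apply: is_derive_eq; rewrite /GRing.scale/=; ring.
- by move=> z0; rewrite mulr_ge0// subr_ge0 ler_expR; lra.
Qed.

Lemma expRDexpRN_le t : (expR t + expR (- t)) / 2 <= expR (t ^+ 2 / 2).
Proof.
wlog t0 : t / 0 <= t.
  move=> h; have [/h//|/ltW t0] := leP 0 t.
  by have := h (- t); rewrite oppr_ge0 opprK sqrrN addrC; exact.
(* Dividing [cosh] by the Gaussian makes the derivative a positive multiple of
   [z cosh z - sinh z]. *)
pose g z : R := 1 - (expR z + expR (- z)) / 2 * expR (- (z ^+ 2 / 2)).
have : g 0 <= g t.
  apply: (@ge0_derive_homo g (fun z => (expR (- z) * (1 + z) - expR z * (1 - z)) / 2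
     * expR (- (z ^+ 2 / 2)))) => // z.
  - by apply: is_derive_eq; rewrite /GRing.scale/=; field.
  - by move=> z0; rewrite mulr_ge0 ?expR_ge0// divr_ge0// subr_ge0 expRM1B_le.
rewrite /g expr0n/= mul0r oppr0 expR0 [expR (- (_ / 2))]expRN.
rewrite (_ : (1 + 1) / 2 * 1 = 1 :> R) ?subrr; last by field.
by rewrite subr_ge0 ler_pdivrMr ?expR_gt0// mul1r.
Qed.

Lemma le_expRDexpRN t : 1 + t ^+ 2 / 2 <= (expR t + expR (- t)) / 2.
Proof.
wlog t0 : t / 0 <= t.
  move=> h; have [/h//|/ltW t0] := leP 0 t.
  by have := h (- t); rewrite oppr_ge0 opprK sqrrN [X in _ <= X / _]addrC; exact.
have t20 : 0 <= t / 2 by rewrite divr_ge0.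
have := double_le_expRBexpRN t20.
rewrite [2 * _]mulrC divfK// => h.
have : t ^+ 2 <= (expR (t / 2) - expR (- (t / 2))) ^+ 2 by rewrite ler_sqr ?nnegrE// (le_trans t0).
rewrite sqr_expRBexpRN; lra.
Qed.

(* [(1 - y) / (1 + y)] is the inverse of [1 + 2 y / (1 - y)]. *)
Lemma expR_le_1B1D y : 0 <= y < 1 -> expR (- (2 * y / (1 - y))) <= (1 - y) / (1 + y).
Proof.
move=> /andP[y0 y1]; rewrite expRN -[leRHS]invrK lef_pV2 ?posrE ?expR_gt0//; last first.
  by rewrite invr_gt0 divr_gt0//; lra.
apply: le_trans (expR_ge1Dx _); rewrite le_eqVlt; apply/orP; left; apply/eqP.
by field; lra.
Qed.

Lemma mul_1B1D_le_expR y : 0 <= y -> (1 - y) / (1 + y) <= expR (- (2 * y)).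
Proof.
move=> y0; rewrite ler_pdivrMr; last lra.
have := expRM1B_le y0; rewrite -(ler_pM2l (expR_gt0 (- y))) !mulrA -!expRD.
rewrite addNr expR0 mul1r => /le_trans; apply; rewrite (_ : - y - y = - (2 * y))//; ring.
Qed.

End exponential_bounds.

(** * Binomial coefficients near the centre *)

Section binomial_ratio.
Context {R : realType}.
Implicit Types n k j : nat.

(* The sum of [n] spins of which [k] are [+1]. *)
Definition bin_dev n k : R := 2 * k%:R - n%:R.

Definition bin_ratio n k : R := 'C(n, k)%:R / 'C(n, n./2)%:R.

Lemma bin_ratio_ge0 n k : 0 <= bin_ratio n k.
Proof. by rewrite divr_ge0. Qed.

Lemma bin_half_gt0 n : 0 < 'C(n, n./2)%:R :> R.
Proof. by rewrite ltr0n bin_gt0 leq_half_double; lia. Qed.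

Lemma bin_dev_half n : -1 <= bin_dev n n./2 <= 0.
Proof.
rewrite /bin_dev -[X in _ - X%:R](odd_double_half n) natrD -muln2 natrM.
by case: (odd n) => /=; lra.
Qed.

Lemma bin_devS n k : bin_dev n k.+1 = bin_dev n k + 2.
Proof. by rewrite /bin_dev -natr1; ring. Qed.

Lemma bin_dev_rev n k : (k <= n)%N -> bin_dev n (n - k) = - bin_dev n k.
Proof. by move=> kn; rewrite /bin_dev natrB//; ring. Qed.

Lemma bin_ratio_rev n k : (k <= n)%N -> bin_ratio n (n - k) = bin_ratio n k.
Proof. by move=> kn; rewrite /bin_ratio bin_sub. Qed.

(** The quotient of neighbouring binomials is [(n - k) / (k + 1)]; taking for [y] the midpoint of
    the deviations at [k] and [k + 1], over [n + 1], gives it a symmetric form. *)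
Lemma binSE n k (y : R) : (k < n)%N -> y = (bin_dev n k + 1) / n.+1%:R ->
  'C(n, k.+1)%:R = 'C(n, k)%:R * ((1 - y) / (1 + y)) :> R.
Proof.
move=> kn ->; rewrite /bin_dev.
have : ((k.+1 * 'C(n, k.+1))%N%:R = ((n - k) * 'C(n, k))%N%:R :> R) by rewrite mul_bin_left.
rewrite !natrM natrB 1?ltnW// -!natr1 => h.
have k0 : 0 <= k%:R :> R by [].
have n0 : 0 <= n%:R :> R by [].
have k1 : k%:R + 1 != 0 :> R by lra.
apply: (mulfI k1); rewrite h; field.
by apply/andP; split; lra.
Qed.

(** Induction on [j]: each new factor is at most [expR (- 2 y)], and the exponents telescope because
    [(s + 2)^2 - s^2 = 4 (s + 1)]. The central deviation is at least [-1], which keeps [y]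
    nonnegative. *)
Lemma bin_le_expR n j (m := n./2) : 'C(n, m + j)%:R <=
  'C(n, m)%:R * expR ((bin_dev n m ^+ 2 - bin_dev n (m + j) ^+ 2) / (2 * n.+1%:R)).
Proof.
elim: j => [|j ih]; first by rewrite addn0 subrr mul0r expR0 mulr1.
have n1 : 0 < n.+1%:R :> R by [].
have [nmj|mjn] := leqP n (m + j); first by rewrite bin_small ?mulr_ge0 ?expR_ge0// addnS ltnS.
rewrite addnS (binSE mjn erefl).
have y0 : 0 <= (bin_dev n (m + j) + 1) / n.+1%:R.
  apply: divr_ge0 => //; have /andP[+ _] := bin_dev_half n.
  rewrite /bin_dev natrD -/m; have : 0 <= j%:R :> R by []. lra.
apply: (le_trans (ler_wpM2l _ (mul_1B1D_le_expR y0))) => //.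
apply: (le_trans (ler_wpM2r (expR_ge0 _) ih)).
rewrite -mulrA -expRD ler_wpM2l// ler_expR le_eqVlt; apply/orP; left; apply/eqP.
by rewrite bin_devS; field; rewrite gt_eqF// -natr1; lra.
Qed.

(** The same product from below. As [y <= 1/2], [2 y / (1 - y) <= 2 y + 4 y^2]; the first terms
    telescope, and each of the [j] quadratic errors is bounded through the final deviation [s]. *)
Lemma bin_ge_expR n j (m := n./2) (s := bin_dev n (m + j)) :
  (m + j <= n)%N -> 2 * s <= n.+1%:R ->
  'C(n, m)%:R * expR ((bin_dev n m ^+ 2 - s ^+ 2) / (2 * n.+1%:R)
    - 4 * j%:R * (s / n.+1%:R) ^+ 2) <= 'C(n, m + j)%:R.
Proof.
rewrite {}/s; elim: j => [|j ih].
  by rewrite addn0 subrr mul0r mulr0 mul0r subr0 expR0 mulr1.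
rewrite addnS bin_devS => mjn sn; rewrite (binSE mjn erefl).
have n1 : 0 < n.+1%:R :> R by [].
have n10 : n.+1%:R != 0 :> R by rewrite gt_eqF.
have s1 : -1 <= bin_dev n (m + j).
  have /andP[+ _] := bin_dev_half n.
  rewrite /bin_dev natrD -/m; have : 0 <= j%:R :> R by []. lra.
have {ih} := ih (ltnW mjn).
set s := bin_dev n (m + j) in s1 sn *; move: sn s1.
have -> : s = (s / n.+1%:R) * n.+1%:R by rewrite divfK.
set N := n.+1%:R in n1 n10 *; set t := s / N => sn s1.
have sn' : 2 * (t * N) <= N by lra.
move=> /(_ sn') ih.
set y := (t * N + 1) / N.
have yE : y * N = t * N + 1 by rewrite /y divfK.
have y0 : 0 <= y by apply: divr_ge0; lra.
have y2 : y <= 1 / 2 by rewrite -(ler_pM2r n1) yE; lra.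
have yy : 0 <= y < 1 by lra.
apply: (le_trans _ (ler_wpM2l _ (expR_le_1B1D yy))) => //.
apply: (le_trans _ (ler_wpM2r (expR_ge0 _) ih)).
rewrite -[leRHS]mulrA -expRD ler_wpM2l// ler_expR.
have h1 : 2 * y / (1 - y) <= 2 * y + 4 * y ^+ 2.
  rewrite ler_pdivrMr; last lra.
  rewrite -subr_ge0 (_ : _ - _ = 2 * y ^+ 2 * (1 - 2 * y)); last by ring.
  by apply: mulr_ge0; [rewrite mulr_ge0 ?sqr_ge0|lra].
pose u := (t * N + 2) / N.
have uN : u * N = t * N + 2 by rewrite /u divfK.
have tE : t * N / N = t by rewrite mulfK.
rewrite -/u tE -(natr1 j).
have yu : y ^+ 2 <= u ^+ 2.
  rewrite ler_sqr ?nnegrE//; first by rewrite -(ler_pM2r n1) yE uN; lra.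
  by apply: divr_ge0; lra.
(* [t] may be as low as [- 1 / N], so comparing squares needs [- u <= t] as well as [t <= u]. *)
have tu : t ^+ 2 <= u ^+ 2.
  have ut : t <= u by rewrite -(ler_pM2r n1) uN; lra.
  have utN : - u <= t by rewrite -(ler_pM2r n1) mulNr uN; lra.
  by rewrite -subr_ge0 subr_sqr mulr_ge0//; lra.
have j0 : 0 <= j%:R :> R by [].
have jtu : j%:R * t ^+ 2 <= j%:R * u ^+ 2 by rewrite ler_wpM2l.
have e : ((t * N + 2) ^+ 2 - (t * N) ^+ 2) / (2 * N) = 2 * y.
  by rewrite /y; field.
have -> : (bin_dev n m ^+ 2 - (t * N + 2) ^+ 2) / (2 * N) =
   (bin_dev n m ^+ 2 - (t * N) ^+ 2) / (2 * N) - 2 * y.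
  by rewrite -e; field.
move: h1 yu jtu; set a := _ / (1 - y); set b := _ / (2 * N).
by move: (y ^+ 2) (u ^+ 2) (t ^+ 2) a b => y2' u2 t2 a b h1 yu jtu; lra.
Qed.

(** By symmetry of the binomials [k] may be taken above the centre. The [1] bounds the square of the
    central deviation. *)
Lemma bin_ratio_le n k : (k <= n)%N ->
  bin_ratio n k <= expR ((1 - bin_dev n k ^+ 2) / (2 * n.+1%:R)).
Proof.
wlog nk : k / (n./2 <= k)%N => [hwlog kn|kn].
  have [/hwlog|nk] := leqP n./2 k; first exact.
  by rewrite -bin_ratio_rev// -sqrrN -bin_dev_rev//; apply: hwlog; lia.
rewrite ler_pdivrMr ?bin_half_gt0// mulrC -{1}(subnKC nk).
apply: (le_trans (bin_le_expR _ _)); rewrite subnKC//.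
rewrite ler_wpM2l// ler_expR ler_pM2r ?invr_gt0 ?mulr_gt0// lerD2r.
by have /andP[? ?] := bin_dev_half n; nra.
Qed.

(** From the centre up to [k] there are at most [(s + 1) / 2] factors, which turns [4 j] into
    [2 (s + 1)]. *)
Lemma bin_ratio_ge n k (s := `|bin_dev n k|) : (k <= n)%N -> 2 * s <= n.+1%:R ->
  expR (- (s ^+ 2 / (2 * n.+1%:R)) - 2 * (s + 1) * (s / n.+1%:R) ^+ 2) <= bin_ratio n k.
Proof.
rewrite {}/s; wlog nk : k / (n./2 <= k)%N => [hwlog kn|kn].
  have [/hwlog|nk] := leqP n./2 k; first exact.
  by rewrite -bin_ratio_rev// -normrN -bin_dev_rev//; apply: hwlog; lia.
move=> sn; rewrite ler_pdivlMr ?bin_half_gt0// mulrC -{2}(subnKC nk).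
have := @bin_ge_expR n (k - n./2); cbv zeta; rewrite subnKC// => /(_ kn) h.
apply: (le_trans _ (h _)); last by apply: le_trans sn; rewrite ler_pM2l// ler_norm.
rewrite ler_wpM2l// ler_expR real_normK ?num_real// [(_ / n.+1%:R) ^+ 2]exprMn real_normK ?num_real//.
rewrite -exprMn lerD//.
  rewrite -mulNr ler_pM2r ?invr_gt0 ?mulr_gt0//.
  by rewrite -[leLHS]add0r lerD2r sqr_ge0.
rewrite lerN2 ler_wpM2r ?sqr_ge0// natrB//.
have /andP[+ _] := bin_dev_half n; have := ler_norm (bin_dev n k); rewrite /bin_dev.
lra.
Qed.

End binomial_ratio.

Section bin_ratio_limit.
Context {R : realType}.

Lemma near_cvg_infty (n : nat -> nat) (P : nat -> Prop) :
  n N @[N --> \oo] --> \oo -> (\forall m \near \oo, P m) ->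
  \forall N \near \oo, P (n N).
Proof. by move=> noo; exact: noo. Qed.

Lemma invr_sqrt_cvg0 (n : nat -> nat) : n N @[N --> \oo] --> \oo ->
  (Num.sqrt (n N)%:R)^-1 @[N --> \oo] --> (0 : R).
Proof.
move=> noo; apply/cvgrPdist_lt => e e0; near=> N.
have n0 : (0 < n N)%N by near: N; exact: (near_cvg_infty noo (nbhs_infty_gt 0)).
rewrite sub0r normrN ger0_norm ?invr_ge0 ?sqrtr_ge0//.
rewrite invf_plt ?posrE ?sqrtr_gt0 ?ltr0n//.
rewrite -ltr_sqr ?nnegrE ?invr_ge0 ?sqrtr_ge0 ?(ltW e0)// sqr_sqrtr//.
by near: N; exact: (near_cvg_infty noo (nbhs_infty_gtr _)).
Unshelve. all: by end_near. Qed.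

(** A local de Moivre-Laplace theorem relative to the central coefficient, by squeezing between the
    two exponential bounds. *)
Lemma bin_ratio_cvg (n k : nat -> nat) (x : R) : n N @[N --> \oo] --> \oo ->
  (\forall N \near \oo, (k N <= n N)%N) ->
  bin_dev (n N) (k N) / Num.sqrt (n N)%:R @[N --> \oo] --> x ->
  bin_ratio (n N) (k N) @[N --> \oo] --> expR (- (x ^+ 2 / 2)).
Proof.
move=> noo kn.
set r := fun N => bin_dev (n N) (k N) / Num.sqrt (n N)%:R => rx.
pose i N : R := (Num.sqrt (n N)%:R)^-1.
have i0 : i N @[N --> \oo] --> 0 by exact: invr_sqrt_cvg0.
have i20 : i N ^+ 2 @[N --> \oo] --> 0 by rewrite -[X in _ --> X](mulr0 0); exact: (cvgM i0 i0).
have i2V : (1 + i N ^+ 2)^-1 @[N --> \oo] --> (1 : R).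
  rewrite -[X in _ --> X]invr1; apply: cvgV; first exact: oner_neq0.
  rewrite -[X in _ --> X]addr0; apply: cvgD => //; exact: cvg_cst.
have r2 : r N ^+ 2 @[N --> \oo] --> x ^+ 2 by exact: (cvgM rx rx).
have ri0 : `|r N| * i N @[N --> \oo] --> 0.
  by rewrite -[X in _ --> X](mulr0 `|x|); apply: cvgM => //; exact: cvg_norm.
(* [U] and [L] are the exponents of [bin_ratio_le] and [bin_ratio_ge], rewritten in [r] and [i]
   alone so that their limits are algebraic. *)
pose U N := (i N ^+ 2 - r N ^+ 2) / 2 * (1 + i N ^+ 2)^-1.
pose L N := - (r N ^+ 2 / 2 * (1 + i N ^+ 2)^-1) -
  2 * (`|r N| * i N + i N ^+ 2) * (r N ^+ 2 * ((1 + i N ^+ 2)^-1 * (1 + i N ^+ 2)^-1)).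
have Ux : U N @[N --> \oo] --> - (x ^+ 2 / 2).
  rewrite -[X in _ --> X]mulr1 -mulNr -[X in X / 2]sub0r; apply: cvgM => //.
  by apply: cvgM; [exact: cvgB|exact: cvg_cst].
have Lx : L N @[N --> \oo] --> - (x ^+ 2 / 2).
  rewrite -[X in _ --> X]subr0; apply: cvgB.
    apply: cvgN; rewrite -[X in _ --> X]mulr1; apply: cvgM => //.
    by apply: cvgM => //; exact: cvg_cst.
  rewrite [X in _ --> X](_ : 0 = 2 * (0 + 0) * (x ^+ 2 * (1 * 1))); last by ring.
  apply: cvgM; last by apply: cvgM => //; exact: cvgM.
  by apply: cvgM; [exact: cvg_cst|exact: cvgD].
have EU : expR (U N) @[N --> \oo] --> expR (- (x ^+ 2 / 2)).
  exact: (cvg_comp _ _ Ux (@continuous_expR R _)).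
have EL : expR (L N) @[N --> \oo] --> expR (- (x ^+ 2 / 2)).
  exact: (cvg_comp _ _ Lx (@continuous_expR R _)).
apply: (squeeze_cvgr _ EL EU); near=> N.
have n0 : (0 < n N)%N by near: N; exact: (near_cvg_infty noo (nbhs_infty_gt 0)).
have knN : (k N <= n N)%N by near: N.
(* This becomes the hypothesis [2 * s <= n.+1] of [bin_ratio_ge]. *)
have ri1 : `|r N| * i N <= 1 / 2.
  near: N; apply: (cvgr_le 0 ri0); rewrite divr_gt0//.
have [w [w0 wE iE]] : exists w : R, [/\ 0 < w, (n N)%:R = w ^+ 2 & i N = w^-1].
  exists (Num.sqrt (n N)%:R); split => //; first by rewrite sqrtr_gt0 ltr0n.
  by rewrite sqr_sqrtr.
have w00 : w != 0 by rewrite gt_eqF.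
have w1 : w ^+ 2 + 1 != 0 by rewrite gt_eqF// ltr_wpDl// sqr_ge0.
have w2 : 1 + (w^-1) ^+ 2 != 0 by rewrite gt_eqF// ltr_wpDr// sqr_ge0.
have sE : bin_dev (n N) (k N) = r N * w.
  by rewrite -[w]invrK -iE /i invrK /r divfK// gt_eqF// sqrtr_gt0 ltr0n.
have nE : (n N).+1%:R = w ^+ 2 + 1 by rewrite -natr1 wE.
have UE : (1 - (r N * w) ^+ 2) / (2 * (w ^+ 2 + 1)) = U N.
  by rewrite /U iE; field; rewrite w00 w1.
have LE : - ((`|r N| * w) ^+ 2 / (2 * (w ^+ 2 + 1))) -
    2 * (`|r N| * w + 1) * ((`|r N| * w) / (w ^+ 2 + 1)) ^+ 2 = L N.
  rewrite /L iE -(real_normK (num_real (r N))); move: `|r N| => a.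
  by field; rewrite w00 w1.
have := @bin_ratio_le R _ _ knN; rewrite sE nE UE => ->; rewrite andbT.
have := @bin_ratio_ge R _ _ knN; cbv zeta.
rewrite sE nE normrM (ger0_norm (ltW w0)) LE; apply.
move: ri1; rewrite iE ler_pdivrMr// => h.
have := ler_wpM2l (ltW w0) h; nra.
Unshelve. all: by end_near. Qed.

End bin_ratio_limit.

(** * Cells around the lattice of normalised sums *)

Section cells.
Context {R : realType}.
Implicit Types (n k : nat) (x : R).

Definition bin_pos n k : R := bin_dev n k / Num.sqrt n%:R.

(* The cells tile the line with the lattice points [bin_pos n k] as centres. *)
Definition cell n k : set R :=
  `[(bin_dev n k - 1) / Num.sqrt n%:R, (bin_dev n k + 1) / Num.sqrt n%:R[%classic.

(** Obtained by solving the membership of [x] in [cell n k] for [k]. Left of cell [0] truncation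
    returns [0], so membership is stated separately where it matters. *)
Definition cell_idx n x : nat := Num.truncn ((Num.sqrt n%:R * x + n%:R + 1) / 2).

Lemma in_cellE n k x : (0 < n)%N -> cell n k x <->
  k%:R <= (Num.sqrt n%:R * x + n%:R + 1) / 2 < k.+1%:R.
Proof.
move=> n0; rewrite /cell/= in_itv/=.
have w0 : 0 < Num.sqrt n%:R :> R by rewrite sqrtr_gt0 ltr0n.
rewrite ler_pdivrMr// ltr_pdivlMr// /bin_dev -(natr1 k).
split => /andP[? ?]; apply/andP; split; lra.
Qed.

Lemma cell_cell_idx n k x : (0 < n)%N -> cell n k x -> cell_idx n x = k.
Proof. by move=> n0 /in_cellE -/(_ n0) xk; exact: truncn_def. Qed.

Lemma cell_dist n k x : (0 < n)%N -> cell n k x ->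
  `|bin_pos n k - x| <= (Num.sqrt n%:R)^-1.
Proof.
move=> n0; rewrite /cell/= in_itv/= /bin_pos.
move: (bin_dev n k) (_^-1) => d i; rewrite mulrBl mulrDl mul1r => /andP[? ?].
by rewrite ler_norml; apply/andP; split; lra.
Qed.

(** The cells [0] to [n] cover [[- (n+1) / sqrt n, (n+1) / sqrt n[], which contains [x] once
    [|x| <= sqrt n]. *)
Lemma near_cell (n : nat -> nat) x : n N @[N --> \oo] --> \oo ->
  \forall N \near \oo, cell (n N) (cell_idx (n N) x) x /\ (cell_idx (n N) x <= n N)%N.
Proof.
move=> noo; near=> N.
have n0 : (0 < n N)%N by near: N; exact: (near_cvg_infty noo (nbhs_infty_gt 0)).
have w0 : 0 < Num.sqrt (n N)%:R :> R by rewrite sqrtr_gt0 ltr0n.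
have xw : `|x| <= Num.sqrt (n N)%:R.
  rewrite -ler_sqr ?nnegrE ?sqrtr_ge0// sqr_sqrtr// ltW//.
  by near: N; exact: (near_cvg_infty noo (nbhs_infty_gtr _)).
have wx : `|Num.sqrt (n N)%:R * x| <= (n N)%:R.
  rewrite normrM gtr0_norm// -[leRHS](@sqr_sqrtr R)// expr2 ler_wpM2l// ltW//.
move: wx; rewrite ler_norml => /andP[wx1 wx2].
split.
  by apply/in_cellE => //; apply: truncn_itv; lra.
rewrite -ltnS -(ltr_nat R); apply: (@le_lt_trans _ _ ((Num.sqrt (n N)%:R * x + (n N)%:R + 1) / 2)).
  by rewrite truncn_le; lra.
by rewrite -(natr1 (n N)); lra.
Unshelve. all: by end_near. Qed.

Lemma bin_pos_cvg (n : nat -> nat) x : n N @[N --> \oo] --> \oo ->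
  bin_pos (n N) (cell_idx (n N) x) @[N --> \oo] --> x.
Proof.
move=> noo; have i0 := @invr_sqrt_cvg0 R _ noo.
apply/cvgrPdist_le => e e0; near=> N.
have n0 : (0 < n N)%N by near: N; exact: (near_cvg_infty noo (nbhs_infty_gt 0)).
have [cx _] : cell (n N) (cell_idx (n N) x) x /\ (cell_idx (n N) x <= n N)%N.
  by near: N; exact: near_cell.
rewrite distrC; apply: (le_trans (cell_dist n0 cx)).
by near: N; apply: (cvgr_le 0 i0).
Unshelve. all: by end_near. Qed.

Lemma bin_ratio_cell_cvg (n : nat -> nat) x : n N @[N --> \oo] --> \oo ->
  bin_ratio (n N) (cell_idx (n N) x) @[N --> \oo] --> expR (- (x ^+ 2 / 2)).
Proof.
move=> noo; apply: bin_ratio_cvg => //; last exact: bin_pos_cvg.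
by near=> N; near: N; apply: filterS (near_cell x noo) => N [].
Unshelve. all: by end_near. Qed.

End cells.

(** * The Hubbard-Stratonovich transform *)

Section dominated_convergence_real.
Context d (T : measurableType d) (R : realType) (mu : {measure set T -> \bar R}).

(** Dominated convergence when the domination holds only eventually, by shifting the sequence. *)
Lemma near_dominated_cvg (f_ : nat -> T -> R) (f g : T -> R) :
  (forall n, measurable_fun [set: T] (f_ n)) -> measurable_fun [set: T] f ->
  (forall x, f_ n x @[n --> \oo] --> f x) ->
  mu.-integrable [set: T] (EFin \o g) ->
  (\forall n \near \oo, forall x, `|f_ n x| <= g x) ->
  mu.-integrable [set: T] (EFin \o f) /\
  (\int[mu]_x (f_ n x)%:E)%E @[n --> \oo] --> (\int[mu]_x (f x)%:E)%E.
Proof.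
move=> mf_ mf f_f ig [n0 _ f_g].
have [|||||h1 _ h2] := @dominated_convergence _ _ _ mu _ measurableT
  (fun n x => (f_ (n + n0)%N x)%:E) (fun x => (f x)%:E) (fun x => (g x)%:E).
- by move=> n; exact/measurable_EFinP.
- exact/measurable_EFinP.
- apply: aeW => x _; apply/fine_cvgP; split; first exact: nearW.
  by have := f_f x; rewrite -(cvg_shiftn n0).
- exact: ig.
- by apply: aeW => x n _; rewrite /= lee_fin f_g//= leq_addl.
by split => //; rewrite -(cvg_shiftn n0).
Qed.

End dominated_convergence_real.

Section gaussian_integrals.
Context {R : realType}.
Local Notation mu := (@lebesgue_measure R).

(** Serves both as the limit of the integrands [bin_tilt] and, with suitable parameters, as a bound
    for them. *)
Definition gauss_tilt (a b z : R) : R :=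
  normal_pdf 0 1 z * expR (a * z + b * z ^+ 2 / 2).

(** Completing the square yields the normal density of mean [a / (1 - b)] and variance
    [1 / (1 - b)]. *)
Lemma gauss_tiltE (a b z : R) : b < 1 -> gauss_tilt a b z =
  (Num.sqrt (1 - b))^-1 * expR (a ^+ 2 / (2 * (1 - b))) *
  normal_pdf (a / (1 - b)) (Num.sqrt (1 - b))^-1 z.
Proof.
move=> b1; have b0 : 0 < 1 - b by rewrite subr_gt0.
have s0 : 0 < Num.sqrt (1 - b) by rewrite sqrtr_gt0.
rewrite /gauss_tilt !normal_pdfE ?oner_neq0// ?invr_neq0 ?gt_eqF//.
rewrite /normal_peak /normal_fun -[LHS]mulrA -expRD mulrACA -expRD.
have -> : (Num.sqrt (1 - b))^-1 * (Num.sqrt ((Num.sqrt (1 - b))^-1 ^+ 2 * pi *+ 2))^-1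
    = (Num.sqrt (1 ^+ 2 * pi *+ 2))^-1.
  rewrite -mulrnAr sqrtrM ?sqr_ge0// sqrtr_sqr ger0_norm ?invr_ge0 ?sqrtr_ge0//.
  by rewrite invfM invrK mulrA mulVf ?gt_eqF// mul1r expr1n mul1r.
congr (_ * expR _); rewrite exprVn sqr_sqrtr ?ltW//.
by field; rewrite gt_eqF.
Qed.

Lemma measurable_gauss_tilt (a b : R) : measurable_fun [set: R] (gauss_tilt a b).
Proof.
apply: measurable_funM; first exact: measurable_normal_pdf.
apply: measurableT_comp => //; apply: measurable_funD; first exact: measurable_funM.
by apply: measurable_funM => //; apply: measurable_funM => //; exact: measurable_funX.
Qed.

Lemma integral_gauss_tilt (a b : R) : b < 1 ->
  (\int[mu]_z (gauss_tilt a b z)%:E =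
   ((Num.sqrt (1 - b))^-1 * expR (a ^+ 2 / (2 * (1 - b))))%:E)%E.
Proof.
move=> b1; under eq_integral do rewrite gauss_tiltE// EFinM.
rewrite ge0_integralZl//= ?integral_normal_pdf ?mule1//.
- by apply/measurable_EFinP; exact: measurable_normal_pdf.
- by move=> z _; rewrite lee_fin normal_pdf_ge0.
Qed.

Lemma gauss_tilt_ge0 (a b z : R) : 0 <= gauss_tilt a b z.
Proof. by rewrite mulr_ge0 ?expR_ge0// normal_pdf_ge0. Qed.

Lemma integrable_gauss_tilt (a b : R) : b < 1 ->
  mu.-integrable [set: R] (EFin \o gauss_tilt a b).
Proof.
move=> b1; apply/integrableP; split.
  by apply/measurable_EFinP; exact: measurable_gauss_tilt.
under eq_integral do rewrite /= ger0_norm ?gauss_tilt_ge0//.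
by rewrite integral_gauss_tilt// ltry.
Qed.

End gaussian_integrals.

Section binomial_mixture.
Context {R : realType}.
Local Notation mu := (@lebesgue_measure R).
Implicit Types (t s : R) (n : nat).

(** The mean of [expR ((t * (s + S)) ^+ 2 / 2)] for [S] a sum of [n] independent fair signs. With
    [t ^+ 2 = beta / N] it is the weight contributed by the third group. *)
Definition bin_mix t n s : R := (2 ^+ n)^-1 *
  \sum_(m < n.+1) 'C(n, m)%:R * expR ((t * (s + bin_dev n m)) ^+ 2 / 2).

Definition bin_tilt t n s z : R := normal_pdf 0 1 z *
  (expR (t * s * z) * ((expR (t * z) + expR (- (t * z))) / 2) ^+ n).

Lemma bin_mix_ge0 t n s : 0 <= bin_mix t n s.
Proof.
rewrite mulr_ge0 ?invr_ge0 ?exprn_ge0//.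
by apply: sumr_ge0 => m _; rewrite mulr_ge0 ?expR_ge0.
Qed.

Lemma bin_tilt_ge0 t n s z : 0 <= bin_tilt t n s z.
Proof.
by rewrite !mulr_ge0 ?normal_pdf_ge0 ?expR_ge0// exprn_ge0// divr_ge0// addr_ge0 ?expR_ge0.
Qed.

Lemma measurable_bin_tilt t n s : measurable_fun [set: R] (bin_tilt t n s).
Proof.
apply: measurable_funM; first exact: measurable_normal_pdf.
apply: measurable_funM.
  by apply: measurableT_comp => //; exact: measurable_funM.
apply: measurable_funX; apply: measurable_funM => //.
by apply: measurable_funD; apply: measurableT_comp => //; exact: measurableT_comp.
Qed.

(** Binomial expansion of the power of [cosh]: each term is a Gaussian with a linear tilt only,
    whose integral is known. *)
Lemma bin_tiltE t n s z : bin_tilt t n s z =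
  \sum_(m < n.+1) (2 ^+ n)^-1 * 'C(n, m)%:R * gauss_tilt (t * (s + bin_dev n m)) 0 z.
Proof.
rewrite /bin_tilt expr_div_n [expR (t * z) + _]addrC exprDn.
rewrite [_ / 2 ^+ n]mulrC mulrA mulrA mulr_sumr; apply: eq_bigr => m _.
rewrite /gauss_tilt mul0r mul0r addr0 -mulr_natl.
rewrite -(expRM_natl (n - m)) -(expRM_natl m) -expRD natrB; last by rewrite -ltnS.
have -> : t * (s + bin_dev n m) * z =
    t * s * z + ((n%:R - m%:R) * - (t * z) + m%:R * (t * z)).
  by rewrite /bin_dev; ring.
by rewrite [in RHS]expRD; ring.
Qed.

(* Hubbard-Stratonovich: [expR (c ^+ 2 / 2)] is the Laplace transform at [c] of
   a standard normal variable, which turns the square into a product. *)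
Lemma integral_bin_tilt t n s :
  (\int[mu]_z (bin_tilt t n s z)%:E = (bin_mix t n s)%:E)%E.
Proof.
under eq_integral do rewrite bin_tiltE -sumEFin.
rewrite ge0_integral_sum//; last 2 first.
- by move=> m; apply/measurable_EFinP; apply: measurable_funM => //; exact: measurable_gauss_tilt.
- by move=> m z _; rewrite lee_fin mulr_ge0 ?gauss_tilt_ge0// mulr_ge0// invr_ge0 exprn_ge0.
rewrite /bin_mix mulr_sumr -sumEFin; apply: eq_bigr => m _.
under eq_integral do rewrite EFinM.
rewrite ge0_integralZl//=; last 2 first.
- by apply/measurable_EFinP; exact: measurable_gauss_tilt.
- by move=> z _; rewrite lee_fin gauss_tilt_ge0.
by rewrite integral_gauss_tilt// subr0 sqrtr1 invr1 mul1r mulr1 -EFinM mulrA.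
Qed.

Lemma bin_tilt_le t n s z : bin_tilt t n s z <= gauss_tilt (t * s) (n%:R * t ^+ 2) z.
Proof.
rewrite /bin_tilt /gauss_tilt expRD ler_wpM2l ?normal_pdf_ge0// ler_wpM2l ?expR_ge0//.
rewrite (_ : n%:R * t ^+ 2 * z ^+ 2 / 2 = n%:R * ((t * z) ^+ 2 / 2)); last by field.
by rewrite expRM_natl lerXn2r ?nnegrE ?expR_ge0 ?expRDexpRN_le.
Qed.

Lemma bin_mix_le t n s (b := n%:R * t ^+ 2) : b < 1 ->
  bin_mix t n s <= (Num.sqrt (1 - b))^-1 * expR ((t * s) ^+ 2 / (2 * (1 - b))).
Proof.
move=> b1; rewrite -lee_fin -integral_bin_tilt -integral_gauss_tilt//.
apply: ge0_le_integral => //.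
- by move=> z _; rewrite lee_fin bin_tilt_ge0.
- by apply/measurable_EFinP; exact: measurable_bin_tilt.
- by apply/measurable_EFinP; exact: measurable_gauss_tilt.
- by move=> z _; rewrite lee_fin bin_tilt_le.
Qed.

(** Puts the lower bound [1 + u] on [cosh] in exponential form, so that its [n]-th power can be
    compared with [expR (n u)]. *)
Lemma expR_le_1D (u : R) : 0 <= u -> expR (u * (1 + u)^-1) <= 1 + u.
Proof.
move=> u0; have u1 : 0 < 1 + u by lra.
rewrite -[leRHS]invrK -[leLHS]invrK -expRN lef_pV2 ?posrE ?invr_gt0 ?expR_gt0//.
apply: le_trans (expR_ge1Dx _); rewrite le_eqVlt; apply/orP; left; apply/eqP.
by field; lra.
Qed.

Lemma bin_tilt_cvg (t s : nat -> R) (n : nat -> nat) (a b z : R) :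
  t N @[N --> \oo] --> 0 -> t N * s N @[N --> \oo] --> a ->
  (n N)%:R * t N ^+ 2 @[N --> \oo] --> b ->
  bin_tilt (t N) (n N) (s N) z @[N --> \oo] --> gauss_tilt a b z.
Proof.
move=> t0 ta nb; rewrite /bin_tilt /gauss_tilt expRD.
apply: cvgM; first exact: cvg_cst.
apply: cvgM.
  have taz : t N * s N * z @[N --> \oo] --> a * z by apply: cvgM => //; exact: cvg_cst.
  exact: (cvg_comp _ _ taz (@continuous_expR R _)).
pose u N := (t N * z) ^+ 2 / 2.
have u0 : u N @[N --> \oo] --> 0.
  rewrite [X in _ --> X](_ : 0 = (0 * z) * (0 * z) / 2); last by ring.
  apply: cvgM; last exact: cvg_cst.
  by apply: cvgM; apply: cvgM => //; exact: cvg_cst.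
have nu : (n N)%:R * u N @[N --> \oo] --> b * z ^+ 2 / 2.
  rewrite (_ : (fun N => _) = (fun N => ((n N)%:R * t N ^+ 2) * (z ^+ 2 / 2))).
    by rewrite -mulrA; apply: cvgM => //; exact: cvg_cst.
  by apply/funext => N; rewrite /u; ring.
have nu1 : (n N)%:R * u N * (1 + u N)^-1 @[N --> \oo] --> b * z ^+ 2 / 2.
  rewrite -[X in _ --> X]mulr1; apply: cvgM => //.
  rewrite -[X in _ --> X]invr1; apply: cvgV; first exact: oner_neq0.
  by rewrite -[X in _ --> X]addr0; apply: cvgD => //; exact: cvg_cst.
(* The power of [cosh] lies between [expR (n u / (1 + u))] and [expR (n u)], and [u] tends to
   [0]. *)
apply: (squeeze_cvgr _ (cvg_comp _ _ nu1 (@continuous_expR R _))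
  (cvg_comp _ _ nu (@continuous_expR R _))).
apply: nearW => N /=.
have u_ge0 : 0 <= u N by rewrite divr_ge0// sqr_ge0.
rewrite -mulrA !expRM_natl !lerXn2r ?nnegrE ?expR_ge0 ?expRDexpRN_le//.
exact: le_trans (expR_le_1D u_ge0) (le_expRDexpRN _).
Qed.

(** According to the sign of [z], one of the tilts [a'] and [- a'] dominates; their sum is a bound
    free of [|z|]. *)
Lemma gauss_tilt_norm_le (a a' b b' z : R) : `|a| <= a' -> b <= b' ->
  gauss_tilt a b z <= gauss_tilt a' b' z + gauss_tilt (- a') b' z.
Proof.
move=> aa' bb'; rewrite /gauss_tilt -mulrDr ler_wpM2l ?normal_pdf_ge0//.
have bz : b * z ^+ 2 / 2 <= b' * z ^+ 2 / 2.
  by rewrite ler_pM2r ?invr_gt0// ler_wpM2r ?sqr_ge0.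
have : a * z <= a' * `|z|.
  by apply: le_trans (ler_norm _) _; rewrite normrM ler_wpM2r.
have [z0|z0] := ger0P z => az.
- by apply: ler_wpDr; rewrite ?expR_ge0// ler_expR lerD.
- by apply: ler_wpDl; rewrite ?expR_ge0// ler_expR lerD// mulNr -mulrN.
Qed.

Lemma bin_mix_cvg (t s : nat -> R) (n : nat -> nat) (a b : R) : b < 1 ->
  t N @[N --> \oo] --> 0 -> t N * s N @[N --> \oo] --> a ->
  (n N)%:R * t N ^+ 2 @[N --> \oo] --> b ->
  bin_mix (t N) (n N) (s N) @[N --> \oo] -->
    (Num.sqrt (1 - b))^-1 * expR (a ^+ 2 / (2 * (1 - b))).
Proof.
move=> b1 t0 ta nb.
(* The parameters eventually lie below [a'] and [b']; as [b'] is midway between [b] and [1], the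
   bound remains integrable. *)
pose a' := `|a| + 1; pose b' := (b + 1) / 2.
have b'1 : b' < 1 by rewrite /b'; lra.
have [|||||_] := @near_dominated_cvg _ _ _ mu (fun N => bin_tilt (t N) (n N) (s N))
   (gauss_tilt a b) (fun z => gauss_tilt a' b' z + gauss_tilt (- a') b' z).
- by move=> N; exact: measurable_bin_tilt.
- exact: measurable_gauss_tilt.
- by move=> z; exact: bin_tilt_cvg.
- rewrite (_ : _ \o _ = (EFin \o gauss_tilt a' b') \+ (EFin \o gauss_tilt (- a') b'))%E//.
  by apply: integrableD => //; exact: integrable_gauss_tilt.
- near=> N => z; rewrite ger0_norm ?bin_tilt_ge0//.
  apply: (le_trans (bin_tilt_le _ _ _ _)); apply: gauss_tilt_norm_le.
    near: N; apply: (cvgr_le `|a|); first exact: cvg_norm.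
    by rewrite /a' ltrDl.
  by near: N; apply: (cvgr_le b) => //; rewrite /b'; lra.
under eq_fun do rewrite integral_bin_tilt.
by rewrite integral_gauss_tilt// => /fine_cvgP[].
Unshelve. all: by end_near. Qed.

End binomial_mixture.

(** * Counting configurations *)

Section subset_sums.
Import mathcomp.boot.fintype mathcomp.boot.finset.
Context {R : realType} {T : finType}.
Implicit Types A B D U X : {set T}.

(** A subset of [U] amounts to a subset of [A] together with a subset of [U :\: A]. *)
Lemma sum_subset_split U A (G : {set T} -> {set T} -> R) : A \subset U ->
  \sum_(X : {set T} | X \subset U) G (X :&: A) (X :\: A) =
  \sum_(D : {set T} | D \subset A) \sum_(E : {set T} | E \subset U :\: A) G D E.
Proof.
move=> AU; rewrite pair_big/=.
rewrite (reindex_onto (fun X => (X :&: A, X :\: A)) (fun p => p.1 :|: p.2))/=.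
  apply: eq_bigl => X; rewrite subsetIr/= setID eqxx andbT.
  rewrite -{1}(setID X A) subUset (subset_trans (subsetIr _ _) AU)/=.
  have d : [disjoint X :\: A & A]%B by rewrite disjoints_subset setDE subsetIr.
  by rewrite subsetD d andbT.
move=> [D E]/= /andP[DA]; rewrite subsetD => /andP[_ EA].
have E0 : E :&: A = set0 by apply/eqP; rewrite setI_eq0.
rewrite !setIUl !setDUl E0 setU0 (setIidPl DA).
have -> : D :\: A = set0 by apply/eqP; rewrite setD_eq0.
by rewrite set0U; congr (_, _); apply/setDidPl; rewrite -setI_eq0 E0.
Qed.

Lemma sum_subset_card A (g : nat -> R) :
  \sum_(D : {set T} | D \subset A) g #|D| = \sum_(k < #|A|.+1) 'C(#|A|, k)%:R * g k.
Proof.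
rewrite (partition_big (fun D => inord #|D| : 'I_#|A|.+1) xpredT)//=.
apply: eq_bigr => k _.
rewrite -(cards_draws A k) mulr_natl -sumr_const; apply: eq_big => [D|D /andP[DA /eqP <-]].
  rewrite inE; apply: andb_id2l => DA.
  by rewrite -val_eqE/= inordK// ltnS subset_leq_card.
by rewrite inordK// ltnS subset_leq_card.
Qed.

Lemma sum_set_card3 A B (F : nat -> nat -> nat -> R)
    (C := ~: (A :|: B)) : [disjoint A & B]%B ->
  \sum_(X : {set T}) F #|X :&: A| #|X :&: B| #|X :&: C| =
  \sum_(k < #|A|.+1) 'C(#|A|, k)%:R * (\sum_(l < #|B|.+1) 'C(#|B|, l)%:R *
    (\sum_(m < #|C|.+1) 'C(#|C|, m)%:R * F k l m)).
Proof.
move=> AB; have BA : B \subset [set: T] :\: A.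
  by rewrite subsetD subsetT disjoint_sym.
have CE : ([set: T] :\: A) :\: B = C by rewrite setDDl setTD.
transitivity (\sum_(X : {set T} | X \subset [set: T])
    (fun D E => F #|D| #|E :&: B| #|E :\: B|) (X :&: A) (X :\: A)).
  apply: eq_big => [X|X _]; first by rewrite subsetT.
  congr (F _ _ _); apply: eq_card => i; rewrite !inE.
    by have [iA|iA] := boolP (i \in A); rewrite ?(disjointFr AB iA) ?andbF//.
  by rewrite negb_or; do 2 case: (_ \in _) => //=; rewrite ?andbT ?andbF.
rewrite (sum_subset_split (fun D E => F #|D| #|E :&: B| #|E :\: B|)) ?subsetT//.
pose H k l := \sum_(m < #|C|.+1) 'C(#|C|, m)%:R * F k l m.
rewrite -(sum_subset_card A (fun k => \sum_(l < #|B|.+1) 'C(#|B|, l)%:R * H k l)).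
apply: eq_bigr => D _.
rewrite (sum_subset_split (fun D' E => F #|D| #|D'| #|E|) BA) CE.
rewrite -(sum_subset_card B (H #|D|)).
by apply: eq_bigr => D' _; rewrite (sum_subset_card C (F #|D| #|D'|)).
Qed.

End subset_sums.

Section spin_sums.
Import mathcomp.boot.fintype mathcomp.boot.finset.
Context {R : realType} (N : nat).
Implicit Types (A B : {set 'I_N}) (x : spins N).

Definition plus_spins x : {set 'I_N} := [set i | x i].

Lemma sum_spinE A x :
  \sum_(i in A) spin R i x = bin_dev #|A| #|plus_spins x :&: A|.
Proof.
rewrite /bin_dev (bigID (fun i => x i))/=.
rewrite (eq_bigr (fun=> 1)); last by move=> i /andP[_ xi]; rewrite /spin xi.
rewrite [X in _ + X](eq_bigr (fun=> -1)); last first.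
  by move=> i /andP[_ /negbTE xi]; rewrite /spin xi.
rewrite !sumr_const -(cardsID (plus_spins x) A) natrD.
have -> : #|[pred i in A | x i]| = #|A :&: plus_spins x|.
  by apply: eq_card => i; rewrite !inE.
have -> : #|[pred i in A | ~~ x i]| = #|A :\: plus_spins x|.
  by apply: eq_card => i; rewrite !inE andbC.
by rewrite [plus_spins x :&: A]setIC mulNrn; ring.
Qed.

(** A configuration is identified with the set of its [+1] spins, and the total spin is split over
    the three groups. *)
Lemma sum_spins A B (F : R -> R -> R -> R) (c := (N - #|A| - #|B|)%N) :
  [disjoint A & B]%B ->
  \sum_(x : spins N) F (\sum_(i in A) spin R i x) (\sum_(i in B) spin R i x)
      (\sum_(i < N) spin R i x) =
  \sum_(k < #|A|.+1) 'C(#|A|, k)%:R * (\sum_(l < #|B|.+1) 'C(#|B|, l)%:R *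
    (\sum_(m < c.+1) 'C(c, m)%:R * F (bin_dev #|A| k) (bin_dev #|B| l)
       (bin_dev #|A| k + bin_dev #|B| l + bin_dev c m))).
Proof.
move=> AB; pose C := ~: (A :|: B).
have cE : c = #|C|.
  by rewrite /c /C [RHS]cardsCs setCK card_ord cardsU (disjoint_setI0 AB) cards0 subn0 subnDA.
have SE x : \sum_(i < N) spin R i x = \sum_(i in A) spin R i x +
    \sum_(i in B) spin R i x + \sum_(i in C) spin R i x.
  have <- : \sum_(i | i \in A :|: B) spin R i x =
      \sum_(i in A) spin R i x + \sum_(i in B) spin R i x.
    rewrite -[RHS](@bigU _ _ _ _ (mem A) (mem B))//.
    by apply: eq_bigl => i; rewrite !inE.
  rewrite (bigID (fun i => i \in A :|: B))/=.
  by congr (_ + _); apply: eq_bigl => i; rewrite !inE.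
under eq_bigr do rewrite SE !sum_spinE.
rewrite cE -(sum_set_card3 (fun k l m => F (bin_dev #|A| k) (bin_dev #|B| l)
       (bin_dev #|A| k + bin_dev #|B| l + bin_dev #|C| m)) AB).
rewrite (reindex plus_spins)//=.
exists (fun X : {set 'I_N} => [ffun i => i \in X] : spins N) => x _.
  by apply/ffunP => i; rewrite ffunE inE.
by apply/setP => i; rewrite inE ffunE.
Qed.

(** The innermost sum, over the third group, is [2 ^+ c] times [bin_mix]. *)
Lemma sum_normalized_spins (beta : R) A B (f : R * R -> R) (c := (N - #|A| - #|B|)%N) :
  0 <= beta -> [disjoint A & B]%B ->
  \sum_(x : spins N) cw_weight beta x * f (normalized_sums A B x) =
  2 ^+ c * \sum_(k < #|A|.+1) \sum_(l < #|B|.+1) 'C(#|A|, k)%:R * 'C(#|B|, l)%:R *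
    (f (bin_pos #|A| k, bin_pos #|B| l) *
     bin_mix (Num.sqrt (beta / N%:R)) c (bin_dev #|A| k + bin_dev #|B| l)).
Proof.
move=> b0 AB.
rewrite (sum_spins (fun a b s => expR (beta / (2 * N%:R) * s ^+ 2) *
  f ((Num.sqrt #|A|%:R)^-1 * a, (Num.sqrt #|B|%:R)^-1 * b)) AB).
rewrite mulr_sumr; apply: eq_bigr => k _.
rewrite mulr_sumr [RHS]mulr_sumr; apply: eq_bigr => l _.
rewrite /bin_pos [bin_dev #|A| k / _]mulrC [bin_dev #|B| l / _]mulrC.
set z := f _; set s := bin_dev #|A| k + bin_dev #|B| l.
have -> : \sum_(m < c.+1) 'C(c, m)%:R * (expR (beta / (2 * N%:R) *
    (s + bin_dev c m) ^+ 2) * z) = 2 ^+ c * (z * bin_mix (Num.sqrt (beta / N%:R)) c s).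
  rewrite /bin_mix [z * _]mulrCA mulVKf ?expf_neq0// mulr_sumr; apply: eq_bigr => m _.
  have -> : (Num.sqrt (beta / N%:R) * (s + bin_dev c m)) ^+ 2 / 2 =
      beta / (2 * N%:R) * (s + bin_dev c m) ^+ 2.
    by rewrite exprMn sqr_sqrtr ?divr_ge0// invfM; ring.
  by ring.
by ring.
Qed.

End spin_sums.

(** * Expectations, densities and step functions *)

Section curie_weiss_expectation.
Context {R : realType} (N : nat) (beta : R).

(** [g] is a finite combination of indicators of single configurations. *)
Lemma integral_curie_weiss (g : spins N -> R) :
  (\int[curie_weiss N beta]_x (g x)%:E =
   ((cw_Z N beta)^-1 * \sum_(x : spins N) cw_weight beta x * g x)%:E)%E.
Proof.
transitivity (\int[curie_weiss N beta]_x
    (\sum_(y : spins N) (g y)%:E * (\1_[set y] x)%:E))%E.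
  apply: eq_integral => x _; under eq_bigr do rewrite -EFinM.
  rewrite sumEFin (bigD1 x)//= indicE mem_set// mulr1 big1 ?addr0// => y yx.
  by rewrite indicE memNset ?mulr0// => /= xy; rewrite xy eqxx in yx.
rewrite integral_sum//; last first.
  by move=> y; apply: integrableZl => //; exact: integrable_indic.
rewrite mulr_sumr -sumEFin; apply: eq_bigr => y _.
rewrite integralZl//; last exact: integrable_indic.
rewrite integral_indic// setIT /= /curie_weiss fsbig_set1 -EFinM.
by congr EFin; rewrite /cw_pmf; ring.
Qed.

End curie_weiss_expectation.

Section integral_density.
Local Open Scope ereal_scope.
Context d d' (T : measurableType d) (T' : measurableType d') (R : realType).
Variables (mu : {measure set T -> \bar R}) (nu : {measure set T' -> \bar R}).
Variables (phi : T' -> T) (p : T -> R).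
Hypothesis mphi : measurable_fun [set: T'] phi.
Hypothesis p0 : forall x, (0 <= p x)%R.
Hypothesis mp : measurable_fun [set: T] p.
Hypothesis nuE : forall A, measurable A -> 
  nu (phi @^-1` A) = \int[mu]_(x in A) (p x)%:E.

Import HBNNSimple.

(** Change of variables when the image of [nu] under [phi] has density [p]: monotone approximation
    by simple functions reduces it to indicators, where it is [nuE]. *)
Lemma ge0_integral_density (f : T -> \bar R) : (forall x, 0 <= f x) ->
  measurable_fun [set: T] f -> \int[nu]_x f (phi x) = \int[mu]_x (f x * (p x)%:E).
Proof.
move=> f0 mf; pose h := nnsfun_approx measurableT mf.
have mpE : measurable_fun [set: T] (EFin \o p) by exact/measurable_EFinP.
have hf x : (h n x)%:E @[n --> \oo] --> f x by exact: cvg_nnsfun_approx.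
have hfp x : (h n x)%:E * (p x)%:E @[n --> \oo] --> f x * (p x)%:E by exact: cvgeZr.
under eq_integral do rewrite -(cvg_lim _ (hf _))//.
under [RHS]eq_integral do rewrite -(cvg_lim _ (hfp _))//.
rewrite monotone_convergence//; last 3 first.
- by move=> n; apply/measurable_EFinP; exact: measurableT_comp.
- by move=> n x _; rewrite lee_fin.
- by move=> x _ a b ab; rewrite lee_fin; exact/lefP/nd_nnsfun_approx.
rewrite monotone_convergence//; last 3 first.
- by move=> n; apply: emeasurable_funM => //; exact/measurable_EFinP.
- by move=> n x _; rewrite mule_ge0 ?lee_fin.
- move=> x _ a b ab; rewrite lee_wpmul2r ?lee_fin//; exact/lefP/nd_nnsfun_approx.
congr (limn _); apply/funext => n.
have mindic r : measurable_fun [set: T] (fun x => (\1_(h n @^-1` [set r]) x)%:E).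
  exact/measurable_EFinP.
have indic0 r x : 0 <= (r * \1_(h n @^-1` [set r]) x)%:E by exact: nnfun_muleindic_ge0.
have mrindic r : measurable_fun [set: T] (fun x => (r * \1_(h n @^-1` [set r]) x)%:E).
  by apply/measurable_EFinP; exact: measurable_funM.
transitivity (\int[nu]_x
   (\sum_(r \in range (h n)) (r * \1_(h n @^-1` [set r]) (phi x))%:E)).
  by apply: eq_integral => x _; rewrite fimfunE -fsumEFin.
transitivity (\int[mu]_x
   (\sum_(r \in range (h n)) (r * \1_(h n @^-1` [set r]) x)%:E * (p x)%:E)); last first.
  apply: eq_integral => x _.
  by rewrite -ge0_mule_fsuml// fsumEFin// -fimfunE.
have mrindicphi r : measurable_fun [set: T'] (fun x => (r * \1_(h n @^-1` [set r]) (phi x))%:E).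
  exact: measurableT_comp (mrindic r) mphi.
rewrite !ge0_integral_fsum//; last 2 first.
- by move=> r; apply: emeasurable_funM.
- by move=> r x _; rewrite mule_ge0// lee_fin.
apply: eq_fsbigr => r; rewrite inE => -[t _ <-].
under eq_integral do rewrite EFinM.
under [RHS]eq_integral do rewrite EFinM -muleA.
rewrite ge0_integralZl ?lee_fin//; last exact: measurableT_comp (mindic R _) mphi.
rewrite ge0_integralZl ?lee_fin//; last 2 first.
- exact: emeasurable_funM.
- by move=> x _; rewrite mule_ge0 ?lee_fin.
have mphi1 : measurable (phi @^-1` (h n @^-1` [set h n t])).
  by rewrite -[X in measurable X]setTI; exact: mphi.
congr (_ * _); transitivity (nu (phi @^-1` (h n @^-1` [set h n t]))).
  by rewrite -[in RHS](setIT (phi @^-1` _)) -integral_indic.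
rewrite nuE// [LHS]integral_mkcond.
by apply: eq_integral => x _; rewrite epatch_indic muleC.
Qed.

(** Positive and negative parts are handled separately; multiplication by [p >= 0] respects them. *)
Lemma integral_density (f : T -> R) : measurable_fun [set: T] f ->
  \int[nu]_x (f (phi x))%:E = \int[mu]_x (f x * p x)%:E.
Proof.
move=> mf; rewrite integralE [RHS]integralE.
have mfE : measurable_fun [set: T] (EFin \o f) by exact/measurable_EFinP.
have := ge0_integral_density (funeneg_ge0 _) (measurable_funeneg mfE).
have := ge0_integral_density (funepos_ge0 _) (measurable_funepos mfE).
move=> hp hn; transitivity (\int[nu]_x (EFin \o f)^\+ (phi x) -
    \int[nu]_x (EFin \o f)^\- (phi x)).
  by congr (_ - _); apply: eq_integral => x _; rewrite ?funeposE ?funenegE.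
rewrite hp hn.
congr (_ - _); apply: eq_integral => x _.
- by rewrite !funeposE maxe_pMl ?lee_fin// mul0e EFinM.
- by rewrite !funenegE maxe_pMl ?lee_fin// mul0e EFinM mulNe.
Qed.

End integral_density.

Section step_functions.
Context {R : realType}.
Local Notation mu := (@lebesgue_measure R).
Implicit Types (n m : nat) (h : nat -> nat -> R) (z : R * R).

Definition step_fun n m h z : R :=
  \sum_(k < n.+1) \sum_(l < m.+1) h k l * \1_(cell n k `*` cell m l) z.

Lemma measurable_cells n m k l : measurable (cell n k `*` cell m l : set (R * R)).
Proof. by apply: measurableX; exact: measurable_itv. Qed.

Lemma measurable_step_fun n m h : measurable_fun [set: R * R] (step_fun n m h).
Proof.
apply: measurable_sum => k; apply: measurable_sum => l.
by apply: measurable_funM => //; apply: measurable_indic; exact: measurable_cells.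
Qed.

Lemma lebesgue_measure_cell n k : (0 < n)%N ->
  mu (cell n k) = (2 / Num.sqrt n%:R)%:E.
Proof.
move=> n0; rewrite /cell lebesgue_measure_itv/= lte_fin.
have w0 : 0 < (Num.sqrt n%:R)^-1 :> R by rewrite invr_gt0 sqrtr_gt0 ltr0n.
rewrite ltr_pM2r// ifT; last lra.
by rewrite -EFinB; congr EFin; ring.
Qed.

Lemma product_measure_cells n m k l : (0 < n)%N -> (0 < m)%N ->
  (mu \x mu)%E (cell n k `*` cell m l) = (2 / Num.sqrt n%:R * (2 / Num.sqrt m%:R))%:E.
Proof.
move=> n0 m0; rewrite product_measure1E; [|exact: measurable_itv|exact: measurable_itv].
by rewrite EFinM -(lebesgue_measure_cell k n0) -(lebesgue_measure_cell l m0).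
Qed.

(** All rectangles have the same area, so a double sum over the lattice becomes an integral over the
    plane, open to dominated convergence. *)
Lemma integral_step_fun n m h : (0 < n)%N -> (0 < m)%N ->
  (\int[mu \x mu]_z (step_fun n m h z)%:E =
   (2 / Num.sqrt n%:R * (2 / Num.sqrt m%:R) *
     \sum_(k < n.+1) \sum_(l < m.+1) h k l)%:E)%E.
Proof.
move=> n0 m0.
have icell k l : (mu \x mu)%E.-integrable [set: R * R]
    (fun z => (\1_(cell n k `*` cell m l) z)%:E).
  apply/integrableP; split.
    by apply/measurable_EFinP; apply: measurable_indic; exact: measurable_cells.
  under eq_integral do rewrite gee0_abs ?lee_fin//.
  rewrite integral_indic//; last exact: measurable_cells.
  by rewrite setIT [X in (X < _)%E](product_measure_cells k l n0 m0) ltry.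
rewrite mulr_sumr -sumEFin.
under eq_integral do rewrite /step_fun -sumEFin.
have icell' k l : (mu \x mu)%E.-integrable [set: R * R]
    (fun z => (h k l * \1_(cell n k `*` cell m l) z)%:E).
  by under eq_fun do rewrite EFinM; exact: integrableZl.
rewrite integral_sum//; last first.
  by move=> k; under eq_fun do rewrite -sumEFin; exact: integrable_sum.
apply: eq_bigr => k _; rewrite mulr_sumr -sumEFin.
under eq_integral do rewrite -sumEFin.
rewrite integral_sum//; apply: eq_bigr => l _.
under eq_integral do rewrite EFinM.
rewrite integralZl// integral_indic//; last exact: measurable_cells.
by rewrite setIT [X in (_ * X)%E](product_measure_cells k l n0 m0) -EFinM mulrC.
Qed.

Lemma step_funE n m h z : (0 < n)%N -> (0 < m)%N ->
  cell n (cell_idx n z.1) z.1 -> (cell_idx n z.1 <= n)%N ->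
  cell m (cell_idx m z.2) z.2 -> (cell_idx m z.2 <= m)%N ->
  step_fun n m h z = h (cell_idx n z.1) (cell_idx m z.2).
Proof.
move=> n0 m0 cn kn cm lm; rewrite /step_fun.
have kn' : (cell_idx n z.1 < n.+1)%N by [].
have lm' : (cell_idx m z.2 < m.+1)%N by [].
rewrite (bigD1 (Ordinal kn'))//= (bigD1 (Ordinal lm'))//=.
rewrite indicE mem_set ?mulr1; last by split.
rewrite [X in _ + X + _]big1; last first.
  move=> l lne; rewrite indicE memNset ?mulr0// => -[_ /= /(cell_cell_idx m0) e].
  by move: lne; rewrite -val_eqE/= e eqxx.
rewrite [X in _ + X]big1 ?addr0// => k kne; rewrite big1// => l _.
rewrite indicE memNset ?mulr0// => -[/= /(cell_cell_idx n0) e _].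
by move: kne; rewrite -val_eqE/= e eqxx.
Qed.

Lemma step_fun_eq0 n m h z :
  ~ (exists k l, [/\ (k <= n)%N, (l <= m)%N, cell n k z.1 & cell m l z.2]) ->
  step_fun n m h z = 0.
Proof.
move=> nz; rewrite /step_fun big1// => k _; rewrite big1// => l _.
rewrite indicE memNset ?mulr0// => -[/= ck cl]; apply: nz; exists k, l.
by split=> //; rewrite -ltnS.
Qed.

Lemma step_fun_cvg (n m : nat -> nat) (h : nat -> nat -> nat -> R) z (c : R) :
  n N @[N --> \oo] --> \oo -> m N @[N --> \oo] --> \oo ->
  h N (cell_idx (n N) z.1) (cell_idx (m N) z.2) @[N --> \oo] --> c ->
  step_fun (n N) (m N) (h N) z @[N --> \oo] --> c.
Proof.
move=> noo moo; apply: cvg_trans; apply: near_eq_cvg; near=> N.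
have [c1 l1] : cell (n N) (cell_idx (n N) z.1) z.1 /\ (cell_idx (n N) z.1 <= n N)%N.
  by near: N; exact: near_cell.
have [c2 l2] : cell (m N) (cell_idx (m N) z.2) z.2 /\ (cell_idx (m N) z.2 <= m N)%N.
  by near: N; exact: near_cell.
rewrite step_funE//.
  by near: N; exact: (near_cvg_infty noo (nbhs_infty_gt 0)).
by near: N; exact: (near_cvg_infty moo (nbhs_infty_gt 0)).
Unshelve. all: by end_near. Qed.

(** [f] is the pointwise limit of step functions taking its values at the cell centres. *)
Lemma continuous_measurable_fun2 (f : R * R -> R) : continuous f ->
  measurable_fun [set: R * R] f.
Proof.
move=> cf.
pose f_ N := step_fun N N (fun k l => f (bin_pos N k, bin_pos N l)).
apply: (@measurable_fun_cvg _ _ _ _ f_).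
  by move=> N; exact: measurable_step_fun.
have noo : N @[N --> \oo] --> \oo by exact: cvg_id.
move=> [x y] _; apply: (step_fun_cvg (n := id) (m := id)
  (h := fun N k l => f (bin_pos N k, bin_pos N l))) => //=.
have cx := @bin_pos_cvg R _ x noo; have cy := @bin_pos_cvg R _ y noo.
exact: (cvg_comp _ _ (cvg_pair cx cy) (cf (x, y))).
Qed.

End step_functions.

(** * The limiting Gaussian density *)

Section bivariate_density.
Context {R : realType}.

Lemma sum_ord2 (F : 'I_2 -> R) : \sum_(i < 2) F i = F 0 + F 1.
Proof. by rewrite big_ord_recl big_ord1; congr (_ + F _); exact/val_inj. Qed.

Lemma det_mx2 (a b c d : R) : \det (mx2 a b c d) = a * d - b * c.
Proof.
rewrite (expand_det_row _ 0) sum_ord2 /cofactor !det_mx11 !mxE.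
rewrite (_ : lift 0 0 = 1); last exact/val_inj.
rewrite (_ : lift 1 0 = 0); last exact/val_inj.
by rewrite /= expr0 expr1; ring.
Qed.

Lemma invmx_mx2 (a b c d : R) (D := a * d - b * c) : D != 0 ->
  invmx (mx2 a b c d) = mx2 (d / D) (- b / D) (- c / D) (a / D).
Proof.
move=> D0; set M := RHS.
have CM : mx2 a b c d *m M = 1%:M.
  apply/matrixP => i j; rewrite !mxE sum_ord2 !mxE.
  have ord2P (k : 'I_2) : k = 0 \/ k = 1.
    by case: k => [[|[|//]] k2]; [left|right]; exact/val_inj.
  by case: (ord2P i) => ->; case: (ord2P j) => ->;
    rewrite /= ?mulr1n ?mulr0n; move: D0; rewrite /D => D0; field.
by rewrite -[LHS]mulmx1 -CM mulKmx// unitmxE unitfE det_mx2.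
Qed.

(** The pointwise limit of the lattice weights, not normalised: the binomials give the first two
    Gaussians, and the rest is the limit in [bin_mix_cvg] with
    [b = beta * (1 - alpha1 - alpha2)]. *)
Definition limit_density (beta alpha1 alpha2 : R) (z : R * R) : R :=
  expR (- (z.1 ^+ 2 / 2)) * expR (- (z.2 ^+ 2 / 2)) *
  ((Num.sqrt (1 - beta * (1 - alpha1 - alpha2)))^-1 *
   expR ((Num.sqrt beta * (Num.sqrt alpha1 * z.1 + Num.sqrt alpha2 * z.2)) ^+ 2 /
     (2 * (1 - beta * (1 - alpha1 - alpha2))))).

Definition limit_cov (beta alpha1 alpha2 : R) : 'M[R]_2 :=
  mx2 (1 + alpha1 * (beta / (1 - beta)))
      (Num.sqrt (alpha1 * alpha2) * (beta / (1 - beta)))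
      (Num.sqrt (alpha1 * alpha2) * (beta / (1 - beta)))
      (1 + alpha2 * (beta / (1 - beta))).

Variables (beta alpha1 alpha2 : R).
Hypotheses (beta_ge0 : 0 <= beta) (beta_lt1 : beta < 1).
Hypotheses (alpha1_ge0 : 0 <= alpha1) (alpha2_ge0 : 0 <= alpha2).
Local Notation C := (limit_cov beta alpha1 alpha2).

Let e_gt0 : 0 < 1 - beta. Proof. by rewrite subr_gt0. Qed.

Lemma limit_cov_gap : 0 < 1 - beta * (1 - alpha1 - alpha2).
Proof.
rewrite (_ : _ - _ = 1 - beta + beta * (alpha1 + alpha2)); last by ring.
by rewrite ltr_wpDr// mulr_ge0// addr_ge0.
Qed.

Lemma det_limit_cov : \det C = (1 - beta * (1 - alpha1 - alpha2)) / (1 - beta).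
Proof.
rewrite /limit_cov det_mx2.
have -> : Num.sqrt (alpha1 * alpha2) * (beta / (1 - beta)) *
    (Num.sqrt (alpha1 * alpha2) * (beta / (1 - beta))) =
    alpha1 * alpha2 * (beta / (1 - beta)) ^+ 2.
  by rewrite mulrACA -!expr2 sqr_sqrtr// mulr_ge0.
by field; rewrite gt_eqF.
Qed.

Lemma det_limit_cov_gt0 : 0 < \det C.
Proof. by rewrite det_limit_cov divr_gt0 ?limit_cov_gap. Qed.

Lemma bivariate_normal_limit_setT : bivariate_normal (0, 0) C [set: R * R] = 1%E.
Proof.
apply: bivariate_normal_setT; last exact: det_limit_cov_gt0.
- by rewrite !mxE.
- by rewrite mxE/= ltr_wpDr// mulr_ge0// divr_ge0// ltW.
Qed.

(** The quadratic form of the inverse covariance is matched with the exponent of [limit_density].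
    The constant can stay unspecified, since total mass [1] fixes it later. *)
Lemma bivariate_normal_pdf_limit : exists2 c : R, 0 < c &
  forall z, bivariate_normal_pdf (0, 0) C z = c * limit_density beta alpha1 alpha2 z.
Proof.
have g0 := limit_cov_gap.
have s0 : 0 < Num.sqrt (1 - beta * (1 - alpha1 - alpha2)) by rewrite sqrtr_gt0.
exists ((2 * pi * Num.sqrt (\det C))^-1 * Num.sqrt (1 - beta * (1 - alpha1 - alpha2))).
  by rewrite mulr_gt0// invr_gt0 !mulr_gt0 ?pi_gt0// sqrtr_gt0 det_limit_cov_gt0.
move=> z; rewrite /bivariate_normal_pdf /limit_density -[RHS]mulrA; congr (_ * _).
rewrite mulrCA mulVKf ?gt_eqF// -!expRD; congr expR.
have DE : (1 + alpha1 * (beta / (1 - beta))) * (1 + alpha2 * (beta / (1 - beta))) -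
    Num.sqrt (alpha1 * alpha2) * (beta / (1 - beta)) *
    (Num.sqrt (alpha1 * alpha2) * (beta / (1 - beta))) =
    (1 - beta * (1 - alpha1 - alpha2)) / (1 - beta).
  by rewrite -det_limit_cov det_mx2.
rewrite /limit_cov invmx_mx2; last by rewrite DE gt_eqF// divr_gt0.
rewrite DE mxE sum_ord2 !mxE/= !sum_ord2 !mxE/= !subr0.
rewrite exprMn sqr_sqrtr// sqrtrM//.
(* Writing each [alpha] as the square of its root leaves an identity of rational functions for
   [field]. *)
have a1 : alpha1 = Num.sqrt alpha1 ^+ 2 by rewrite sqr_sqrtr.
have a2 : alpha2 = Num.sqrt alpha2 ^+ 2 by rewrite sqr_sqrtr.
clear DE s0.
move: g0 a1 a2; move: (Num.sqrt alpha1) (Num.sqrt alpha2) => p q + a1 a2.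
rewrite a1 a2 => g0.
have g0' : 1 - beta * (1 - p ^+ 2 - q ^+ 2) != 0 by rewrite gt_eqF.
have e0' : 1 - beta != 0 by rewrite gt_eqF.
by field; rewrite e0' g0'.
Qed.

End bivariate_density.

(** * Gaussian domination of the lattice weights *)

Section domination.
Context {R : realType}.
Implicit Types (n m k l N : nat) (beta x : R).

Lemma bin_ratio_le_pos n k : (0 < n)%N -> (k <= n)%N ->
  bin_ratio n k <= expR (1 / 2 - n%:R / n.+1%:R * bin_pos n k ^+ 2 / 2) :> R.
Proof.
move=> n0 kn; apply: (le_trans (bin_ratio_le kn)); rewrite ler_expR.
have w0 : 0 < Num.sqrt n%:R :> R by rewrite sqrtr_gt0 ltr0n.
have -> : bin_dev n k = bin_pos n k * Num.sqrt n%:R :> R by rewrite divfK ?gt_eqF.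
rewrite exprMn sqr_sqrtr//; move: (bin_pos n k) => u.
have n1 : 1 <= n.+1%:R :> R by rewrite ler1n.
have -> : (1 - u ^+ 2 * n%:R) / (2 * n.+1%:R) =
    n.+1%:R^-1 / 2 - n%:R / n.+1%:R * u ^+ 2 / 2 :> R.
  by field; rewrite gt_eqF// (lt_le_trans _ n1).
by rewrite lerD2r ler_pM2r// invf_le1// (lt_le_trans _ n1).
Qed.

(** For the centre [u], [|u - x| <= 1] and [x^2 = 2 u^2 + 2 (u - x)^2 - (2 u - x)^2]. *)
Lemma cell_sqr_ge n k x : (0 < n)%N -> cell n k x ->
  x ^+ 2 / 2 - 1 <= bin_pos n k ^+ 2.
Proof.
move=> n0 /(cell_dist n0) ux.
have : `|bin_pos n k - x| <= 1.
  apply: (le_trans ux); rewrite invf_le1 ?sqrtr_gt0 ?ltr0n//.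
  by rewrite -[leLHS]sqrtr1 ler_wsqrtr// ler1n.
rewrite ler_norml; move: (bin_pos n k) => u /andP[h1 h2].
have t1 : 0 <= 1 - (u - x) by lra.
have t2 : 0 <= 1 + (u - x) by lra.
by have := mulr_ge0 t1 t2; have := sqr_ge0 (2 * u - x); lra.
Qed.

(** Let [th] be the share of the third group. By Cauchy-Schwarz the squared sum of the two
    deviations is at most [N (1 - th) (u^2 + v^2)], and [1 - th <= 1 - beta * th] absorbs the
    denominator coming from [bin_mix_le]. *)
Lemma bin_mix_le_pos beta n m N k l : 0 <= beta -> beta < 1 ->
  (0 < n)%N -> (0 < m)%N -> (n + m <= N)%N ->
  bin_mix (Num.sqrt (beta / N%:R)) (N - n - m) (bin_dev n k + bin_dev m l) <=
  (Num.sqrt (1 - beta))^-1 * expR (beta * (bin_pos n k ^+ 2 + bin_pos m l ^+ 2) / 2).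
Proof.
move=> b0 b1 n0 m0 nmN.
have N0 : 0 < N%:R :> R by rewrite ltr0n; lia.
have e0 : 0 < 1 - beta by rewrite subr_gt0.
have w0 : 0 < Num.sqrt n%:R :> R by rewrite sqrtr_gt0 ltr0n.
have v0 : 0 < Num.sqrt m%:R :> R by rewrite sqrtr_gt0 ltr0n.
have w2 : Num.sqrt n%:R ^+ 2 = n%:R :> R by rewrite sqr_sqrtr.
have v2 : Num.sqrt m%:R ^+ 2 = m%:R :> R by rewrite sqr_sqrtr.
pose th : R := (N - n - m)%N%:R / N%:R.
have th0 : 0 <= th by rewrite divr_ge0.
have thE : (n%:R + m%:R) / N%:R = 1 - th.
  by rewrite /th natrB ?natrB; [field; rewrite gt_eqF|lia|lia].
have th1 : 0 <= 1 - th by rewrite -thE divr_ge0// addr_ge0.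
have bE : (N - n - m)%N%:R * Num.sqrt (beta / N%:R) ^+ 2 = beta * th.
  by rewrite sqr_sqrtr ?divr_ge0// /th; ring.
have bth : beta * th <= beta by rewrite ler_piMr// -subr_ge0.
have bth1 : beta * th < 1 by exact: le_lt_trans b1.
have g0 : 0 < 1 - beta * th by rewrite subr_gt0.
apply: (le_trans (bin_mix_le _ _)); rewrite bE//.
apply: ler_pM; rewrite ?expR_ge0 ?invr_ge0 ?sqrtr_ge0//.
  by rewrite lef_pV2 ?posrE ?sqrtr_gt0// ler_wsqrtr// lerD2l lerN2.
rewrite ler_expR.
have -> : bin_dev n k = bin_pos n k * Num.sqrt n%:R :> R by rewrite divfK ?gt_eqF.
have -> : bin_dev m l = bin_pos m l * Num.sqrt m%:R :> R by rewrite divfK ?gt_eqF.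
rewrite exprMn sqr_sqrtr ?divr_ge0//.
move: (bin_pos n k) (bin_pos m l) => u v.
have cs : (u * Num.sqrt n%:R + v * Num.sqrt m%:R) ^+ 2 <= (n%:R + m%:R) * (u ^+ 2 + v ^+ 2).
  rewrite -[X in (X + _) * _]w2 -[X in (_ + X) * _]v2.
  move: (Num.sqrt n%:R) (Num.sqrt m%:R) => p q.
  by rewrite -subr_ge0 (_ : _ - _ = (u * q - v * p) ^+ 2) ?sqr_ge0//; ring.
rewrite ler_pdivrMr ?mulr_gt0//.
apply: (@le_trans _ _ (beta / N%:R * ((n%:R + m%:R) * (u ^+ 2 + v ^+ 2)))).
  by rewrite ler_wpM2l// divr_ge0.
have -> : beta / N%:R * ((n%:R + m%:R) * (u ^+ 2 + v ^+ 2)) =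
    beta * ((n%:R + m%:R) / N%:R) * (u ^+ 2 + v ^+ 2) by field; rewrite gt_eqF.
rewrite thE.
have -> : beta * (u ^+ 2 + v ^+ 2) / 2 * (2 * (1 - beta * th)) =
    beta * (1 - beta * th) * (u ^+ 2 + v ^+ 2) by field.
rewrite ler_wpM2r ?addr_ge0 ?sqr_ge0// ler_wpM2l// lerD2l lerN2.
by rewrite ler_piMl// ltW.
Qed.

(** In each coordinate the binomial contributes at most [- (1 + beta) u^2 / 4] and the third group
    [beta u^2 / 2], a net [- (1 - beta) u^2 / 4]. Passing from the centre [u] to a point of the cell
    halves the rate to [(1 - beta) / 8]; the additive constants sum to at most [2]. *)
Lemma weight_le beta n m N k l (z : R * R) : 0 <= beta -> beta < 1 ->
  (0 < n)%N -> (0 < m)%N -> (n + m <= N)%N -> (k <= n)%N -> (l <= m)%N ->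
  (1 + beta) / 2 <= n%:R / n.+1%:R -> (1 + beta) / 2 <= m%:R / m.+1%:R ->
  cell n k z.1 -> cell m l z.2 ->
  bin_ratio n k * bin_ratio m l *
    bin_mix (Num.sqrt (beta / N%:R)) (N - n - m) (bin_dev n k + bin_dev m l) <=
  (Num.sqrt (1 - beta))^-1 * expR (2 - (1 - beta) / 8 * (z.1 ^+ 2 + z.2 ^+ 2)).
Proof.
move=> b0 b1 n0 m0 nmN kn lm bn bm cn cm.
have hb := ler_pM (@bin_ratio_ge0 R n k) (bin_ratio_ge0 m l)
  (bin_ratio_le_pos n0 kn) (bin_ratio_le_pos m0 lm).
have hm := bin_mix_le_pos k l b0 b1 n0 m0 nmN.
apply: (le_trans (ler_pM _ (bin_mix_ge0 _ _ _) hb hm)).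
  by rewrite mulr_ge0 ?bin_ratio_ge0.
rewrite mulrCA -!expRD ler_wpM2l ?invr_ge0 ?sqrtr_ge0// ler_expR.
have := cell_sqr_ge n0 cn; have := cell_sqr_ge m0 cm.
have := sqr_ge0 (bin_pos n k : R); have := sqr_ge0 (bin_pos m l : R).
move: (bin_pos n k ^+ 2) (bin_pos m l ^+ 2) => u v v0 u0 hv hu.
have h1 := ler_wpM2r u0 bn; have h2 := ler_wpM2r v0 bm.
move: h1 h2; move: (n%:R / n.+1%:R * u) (m%:R / m.+1%:R * v) => p q h1 h2.
have e0 : 0 <= (1 - beta) / 4 by lra.
have := ler_wpM2l e0 hv; have := ler_wpM2l e0 hu.
by move: (z.1 ^+ 2) (z.2 ^+ 2) => x y; nra.
Qed.

(** A multiple of the product of two centred normal densities of variance [1 / (2 d)], integrated by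
    Tonelli. *)
Lemma integrable_gauss2 (d : R) : 0 < d ->
  (lebesgue_measure \x lebesgue_measure)%E.-integrable [set: R * R]
    (EFin \o (fun z : R * R => expR (- (d * (z.1 ^+ 2 + z.2 ^+ 2))))).
Proof.
move=> d0; pose s := Num.sqrt (2 * d)^-1.
have s0 : s != 0 by rewrite gt_eqF// sqrtr_gt0 invr_gt0 mulr_gt0.
have p0 : 0 < normal_peak s by exact: normal_peak_gt0.
have gE x : expR (- (d * x ^+ 2)) = (normal_peak s)^-1 * normal_pdf 0 s x.
  rewrite normal_pdfE// mulKf ?gt_eqF// /normal_fun /s sqr_sqrtr ?invr_ge0 ?mulr_ge0 ?ltW//.
  by congr expR; field; rewrite gt_eqF.
have mg : measurable_fun [set: R * R] (fun z : R * R => expR (- (d * (z.1 ^+ 2 + z.2 ^+ 2)))).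
  apply: measurableT_comp => //; apply: measurableT_comp => //.
  apply: measurable_funM => //; apply: measurable_funD; apply: measurable_funX.
    exact: measurable_fst.
  exact: measurable_snd.
apply/integrableP; split; first exact/measurable_EFinP.
under eq_integral do rewrite gee0_abs ?lee_fin ?expR_ge0//.
rewrite fubini_tonelli1/=; last 2 first.
- exact/measurable_EFinP.
- by move=> z; rewrite lee_fin expR_ge0.
have mn : measurable_fun [set: R] (fun x => (normal_pdf 0 s x)%:E).
  by apply/measurable_EFinP; exact: measurable_normal_pdf.
have n0 x : (0 <= (normal_pdf 0 s x)%:E)%E by rewrite lee_fin normal_pdf_ge0.
rewrite /fubini_F.
under eq_integral => x _.
  under eq_integral => y _ do rewrite /= mulrDr opprD expRD [expR (- (d * y ^+ 2))]gE mulrA EFinM.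
  rewrite ge0_integralZl//; last by rewrite lee_fin mulr_ge0 ?expR_ge0// invr_ge0 ltW.
  rewrite integral_normal_pdf mule1 gE mulrAC EFinM; over.
rewrite ge0_integralZl//; last by rewrite lee_fin mulr_ge0 ?invr_ge0 ?normal_peak_ge0.
by rewrite integral_normal_pdf mule1 ltry.
Qed.

End domination.

(** * Limit of the unnormalised expectations *)

Section step_representation.
Context {R : realType}.
Implicit Types (n m N k l : nat) (beta : R) (f : R * R -> R).

Definition spin_coef beta N n m f k l : R :=
  bin_ratio n k * bin_ratio m l *
    bin_mix (Num.sqrt (beta / N%:R)) (N - n - m) (bin_dev n k + bin_dev m l) *
    f (bin_pos n k, bin_pos m l).

(** The prefactor is the area of a rectangle of cells, so that for positive [n] and [m] this is the
    integral of the step function of [spin_coef]. *)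
Definition spin_sum beta N n m f : R :=
  2 / Num.sqrt n%:R * (2 / Num.sqrt m%:R) *
    \sum_(k < n.+1) \sum_(l < m.+1) spin_coef beta N n m f k l.

Lemma integral_distribution_spins beta N (A B : {set 'I_N}) f :
  0 <= beta -> (0 < #|A|)%N -> (0 < #|B|)%N -> [disjoint A & B]%B ->
  measurable_fun [set: R * R] f -> bounded_fun f ->
  (\int[distribution (curie_weiss N beta) (normalized_sums A B)]_z (f z)%:E =
   (spin_sum beta N #|A| #|B| f / spin_sum beta N #|A| #|B| (cst 1))%:E)%E.
Proof.
move=> b0 A0 B0 AB mf bf.
have mfE : measurable_fun [set: R * R] (EFin \o f) by exact/measurable_EFinP.
rewrite (integral_distribution mfE); last first.
  apply: (@measurable_bounded_integrable _ _ _ _ (f \o normalized_sums A B)) => //.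
    apply: (@le_lt_trans _ _ 1%E); last by rewrite ltry.
    exact: (probability_le1 (curie_weiss N beta)).
  by have [M [Mr bM]] := bf; exists M; split=> // r Mlr x _; exact: bM.
rewrite /= integral_curie_weiss; congr EFin.
(* [K] gathers the factors independent of [f]: a power of two, the central binomials and the inverse
   cell area. It cancels in the ratio. *)
pose K := 2 ^+ (N - #|A| - #|B|) * ('C(#|A|, #|A|./2)%:R * 'C(#|B|, #|B|./2)%:R) *
  (Num.sqrt #|A|%:R / 2 * (Num.sqrt #|B|%:R / 2)) : R.
have wA : Num.sqrt #|A|%:R != 0 :> R by rewrite gt_eqF// sqrtr_gt0 ltr0n.
have wB : Num.sqrt #|B|%:R != 0 :> R by rewrite gt_eqF// sqrtr_gt0 ltr0n.
have cA : 'C(#|A|, #|A|./2)%:R != 0 :> R by rewrite gt_eqF// bin_half_gt0.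
have cB : 'C(#|B|, #|B|./2)%:R != 0 :> R by rewrite gt_eqF// bin_half_gt0.
have K0 : K != 0.
  by rewrite /K !mulf_neq0// ?expf_neq0// ?invr_eq0 ?pnatr_eq0.
have KE g : \sum_(x : spins N) cw_weight beta x * g (normalized_sums A B x) =
    K * spin_sum beta N #|A| #|B| g.
  rewrite sum_normalized_spins// /K /spin_sum -!mulrA; congr (_ * _).
  have -> : 'C(#|A|, #|A|./2)%:R * ('C(#|B|, #|B|./2)%:R * (Num.sqrt #|A|%:R *
      (2^-1 * (Num.sqrt #|B|%:R * (2^-1 * (2 * ((Num.sqrt #|A|%:R)^-1 *
      (2 * ((Num.sqrt #|B|%:R)^-1 * (\sum_(k < #|A|.+1) \sum_(l < #|B|.+1)
         spin_coef beta N #|A| #|B| g k l)))))))))) =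
      'C(#|A|, #|A|./2)%:R * 'C(#|B|, #|B|./2)%:R * \sum_(k < #|A|.+1)
      \sum_(l < #|B|.+1) spin_coef beta N #|A| #|B| g k l :> R.
    by field; rewrite wA wB.
  rewrite mulr_sumr; apply: eq_bigr => k _; rewrite mulr_sumr; apply: eq_bigr => l _.
  by rewrite /spin_coef /bin_ratio; field; rewrite cA cB.
have -> : cw_Z N beta = \sum_(x : spins N) cw_weight beta x *
    (cst 1 : R * R -> R) (normalized_sums A B x).
  by apply: eq_bigr => x _; rewrite mulr1.
by rewrite !KE invfM mulrACA mulVf// mul1r mulrC.
Qed.

End step_representation.

Lemma mulr_sqr_coupling {R : realType} (beta : R) (N n m : nat) :
  0 <= beta -> (0 < N)%N -> (n + m <= N)%N ->
  (N - n - m)%:R * Num.sqrt (beta / N%:R) ^+ 2 =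
  beta * (1 - n%:R / N%:R - m%:R / N%:R).
Proof.
move=> b0 N0 nmN; have N0' : N%:R != 0 :> R by rewrite pnatr_eq0 -lt0n.
rewrite sqr_sqrtr ?divr_ge0// !natrB; [|lia|lia].
by field.
Qed.

Section spin_sum_limit.
Context {R : realType} (beta alpha1 alpha2 : R) (n m : nat -> nat).
Hypotheses (beta_ge0 : 0 <= beta) (beta_lt1 : beta < 1).
Hypothesis nm_le : \forall N \near \oo, (n N + m N <= N)%N.
Hypotheses (n_infty : n N @[N --> \oo] --> \oo) (m_infty : m N @[N --> \oo] --> \oo).
Hypothesis alpha1_lim : (n N)%:R / N%:R @[N --> \oo] --> alpha1.
Hypothesis alpha2_lim : (m N)%:R / N%:R @[N --> \oo] --> alpha2.
Local Notation mu2 := (lebesgue_measure \x lebesgue_measure)%E.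

Lemma alpha_ge0 : 0 <= alpha1 /\ 0 <= alpha2.
Proof.
split; [apply: (cvgr_to_ge alpha1_lim)|apply: (cvgr_to_ge alpha2_lim)];
  by apply: nearW => N; rewrite divr_ge0.
Qed.

Let gap_lt1 : beta * (1 - alpha1 - alpha2) < 1.
Proof. by have [? ?] := alpha_ge0; rewrite -subr_gt0 limit_cov_gap. Qed.

Let near_gt0 : \forall N \near \oo, (0 < n N)%N /\ (0 < m N)%N.
Proof.
near=> N; split; near: N.
  exact: (near_cvg_infty n_infty (nbhs_infty_gt 0)).
exact: (near_cvg_infty m_infty (nbhs_infty_gt 0)).
Unshelve. all: by end_near. Qed.

Lemma coupling_cvg0 : Num.sqrt (beta / N%:R) @[N --> \oo] --> 0.
Proof.
have h : Num.sqrt beta * (Num.sqrt N%:R)^-1 @[N --> \oo] --> Num.sqrt beta * 0.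
  by apply: cvgM; [exact: cvg_cst|exact: (invr_sqrt_cvg0 (n := id) cvg_id)].
rewrite mulr0 in h; apply: cvg_trans h; apply: near_eq_cvg; apply: nearW => N.
by rewrite sqrtrM// sqrtrV.
Qed.

(** For the first group, [sqrt (beta / N)] times the deviation is [sqrt beta * sqrt (n / N)] times
    the cell centre, which tends to [x]; likewise for the second. *)
Lemma coupling_dev_cvg x y :
  Num.sqrt (beta / N%:R) * (bin_dev (n N) (cell_idx (n N) x) +
    bin_dev (m N) (cell_idx (m N) y)) @[N --> \oo] -->
  Num.sqrt beta * (Num.sqrt alpha1 * x + Num.sqrt alpha2 * y).
Proof.
have s1 := cvg_comp _ _ alpha1_lim (@sqrt_continuous R alpha1).
have s2 := cvg_comp _ _ alpha2_lim (@sqrt_continuous R alpha2).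
have h : Num.sqrt beta * (Num.sqrt ((n N)%:R / N%:R) * bin_pos (n N) (cell_idx (n N) x) +
    Num.sqrt ((m N)%:R / N%:R) * bin_pos (m N) (cell_idx (m N) y)) @[N --> \oo] -->
    Num.sqrt beta * (Num.sqrt alpha1 * x + Num.sqrt alpha2 * y).
  apply: cvgM; first exact: cvg_cst.
  by apply: cvgD; apply: cvgM => //; exact: bin_pos_cvg.
apply: cvg_trans h; apply: near_eq_cvg; near=> N.
have [n0 m0] : (0 < n N)%N /\ (0 < m N)%N by near: N.
have w0 : Num.sqrt (n N)%:R != 0 :> R by rewrite gt_eqF// sqrtr_gt0 ltr0n.
have v0 : Num.sqrt (m N)%:R != 0 :> R by rewrite gt_eqF// sqrtr_gt0 ltr0n.
rewrite !sqrtrM// /bin_pos; move: (Num.sqrt N%:R^-1) => t.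
by field; rewrite w0 v0.
Unshelve. all: by end_near. Qed.

Lemma rest_cvg : (N - n N - m N)%:R * Num.sqrt (beta / N%:R) ^+ 2 @[N --> \oo] -->
  beta * (1 - alpha1 - alpha2).
Proof.
have h : beta * (1 - (n N)%:R / N%:R - (m N)%:R / N%:R) @[N --> \oo] -->
    beta * (1 - alpha1 - alpha2).
  apply: cvgM; first exact: cvg_cst.
  by apply: cvgB => //; apply: cvgB => //; exact: cvg_cst.
apply: cvg_trans h; apply: near_eq_cvg; near=> N.
rewrite mulr_sqr_coupling//; last by near: N.
by near: N; exact: nbhs_infty_gt.
Unshelve. all: by end_near. Qed.

Lemma spin_coef_cvg f (z : R * R) : continuous f ->
  spin_coef beta N (n N) (m N) f (cell_idx (n N) z.1) (cell_idx (m N) z.2)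
    @[N --> \oo] --> limit_density beta alpha1 alpha2 z * f z.
Proof.
move=> cf; apply: cvgM; first (apply: cvgM; first apply: cvgM).
- exact: bin_ratio_cell_cvg.
- exact: bin_ratio_cell_cvg.
- pose s N : R := bin_dev (n N) (cell_idx (n N) z.1) + bin_dev (m N) (cell_idx (m N) z.2).
  pose r N := (N - n N - m N)%N.
  have h := @bin_mix_cvg _ _ s r _ _ gap_lt1 coupling_cvg0 (@coupling_dev_cvg z.1 z.2) rest_cvg.
  exact: h.
have cx := @bin_pos_cvg R _ z.1 n_infty; have cy := @bin_pos_cvg R _ z.2 m_infty.
rewrite [in X in _ --> X](surjective_pairing z); exact: (cvg_comp _ _ (cvg_pair cx cy) (cf (z.1, z.2))).
Qed.

Let near_ratio (p : nat -> nat) : p N @[N --> \oo] --> \oo ->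
  \forall N \near \oo, (1 + beta) / 2 <= (p N)%:R / (p N).+1%:R.
Proof.
move=> poo; near=> N.
(* The goal amounts to [1 + beta <= (1 - beta) p], and [1 + beta < 2]. *)
have : 2 / (1 - beta) < (p N)%:R by near: N; exact: (near_cvg_infty poo (nbhs_infty_gtr _)).
have e0 : 0 < 1 - beta by rewrite subr_gt0.
rewrite ltr_pdivrMr// ler_pdivlMr// -(natr1 (p N)) => h.
have : 0 <= (p N)%:R :> R by []. nra.
Unshelve. all: by end_near. Qed.

(** Dominated convergence for the step functions [F N], bounded by the Gaussian [G] on the cells
    through [weight_le] and zero elsewhere. *)
Lemma spin_sum_cvg f : continuous f -> bounded_fun f ->
  mu2.-integrable [set: R * R] (EFin \o (fun z => limit_density beta alpha1 alpha2 z * f z)) /\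
  (spin_sum beta N (n N) (m N) f)%:E @[N --> \oo] -->
    (\int[mu2]_z (limit_density beta alpha1 alpha2 z * f z)%:E)%E.
Proof.
move=> cf [M0 [_ bM0]].
pose M := `|M0| + 1.
have M_ge0 : 0 <= M by rewrite addr_ge0.
have bM z : `|f z| <= M by apply: bM0 => //; rewrite (le_lt_trans (ler_norm _))// ltrDl.
pose d := (1 - beta) / 8.
have d0 : 0 < d by rewrite divr_gt0// subr_gt0.
pose G (z : R * R) : R := (Num.sqrt (1 - beta))^-1 * expR 2 * M *
  expR (- (d * (z.1 ^+ 2 + z.2 ^+ 2))).
have G0 z : 0 <= G z by rewrite !mulr_ge0 ?expR_ge0// invr_ge0 sqrtr_ge0.
pose F N := step_fun (n N) (m N) (spin_coef beta N (n N) (m N) f).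
have FG : \forall N \near \oo, forall z, `|F N z| <= G z.
  near=> N => z.
  have [n0 m0] : (0 < n N)%N /\ (0 < m N)%N by near: N.
  have nmN : (n N + m N <= N)%N by near: N.
  have bn : (1 + beta) / 2 <= (n N)%:R / (n N).+1%:R by near: N; exact: near_ratio.
  have bm : (1 + beta) / 2 <= (m N)%:R / (m N).+1%:R by near: N; exact: near_ratio.
  have [[k [l [kn lm ck cl]]]|nz] := pselect (exists k l,
    [/\ (k <= n N)%N, (l <= m N)%N, cell (n N) k z.1 & cell (m N) l z.2]); last first.
    by rewrite /F step_fun_eq0// normr0.
  have kE := cell_cell_idx n0 ck; have lE := cell_cell_idx m0 cl.
  rewrite /F step_funE ?kE ?lE// /spin_coef normrM.
  apply: (@le_trans _ _ ((Num.sqrt (1 - beta))^-1 *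
      expR (2 - d * (z.1 ^+ 2 + z.2 ^+ 2)) * M)).
    apply: ler_pM => //; rewrite ger0_norm; first exact: weight_le.
    by rewrite mulr_ge0 ?bin_mix_ge0// mulr_ge0 ?bin_ratio_ge0.
  by rewrite expRD /G; rewrite le_eqVlt; apply/orP; left; apply/eqP; ring.
have iG : mu2.-integrable [set: R * R] (EFin \o G).
  exact: (integrableZl measurableT ((Num.sqrt (1 - beta))^-1 * expR 2 * M)
    (integrable_gauss2 d0)).
have Fcvg z : F N z @[N --> \oo] --> limit_density beta alpha1 alpha2 z * f z.
  by apply: step_fun_cvg => //; exact: spin_coef_cvg.
have mF N : measurable_fun [set: R * R] (F N) by exact: measurable_step_fun.
have mH : measurable_fun [set: R * R] (fun z => limit_density beta alpha1 alpha2 z * f z).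
  by apply: (measurable_fun_cvg mF) => z _; exact: Fcvg.
have [//|//|//|//|//|iH cF] := @near_dominated_cvg _ _ _ mu2 F
  (fun z => limit_density beta alpha1 alpha2 z * f z) G.
split => //; apply: cvg_trans cF; apply: near_eq_cvg; near=> N.
have [n0 m0] : (0 < n N)%N /\ (0 < m N)%N by near: N.
by rewrite /F integral_step_fun.
Unshelve. all: by end_near. Qed.

End spin_sum_limit.

(** * Integration against the limit law and conclusion *)

Lemma integral_bivariate_normal {R : realType} (m : R * R) (C : 'M[R]_2) (g : R * R -> R) :
  measurable_fun [set: R * R] g ->
  (\int[bivariate_normal m C]_z (g z)%:E =
   \int[lebesgue_measure \x lebesgue_measure]_z (g z * bivariate_normal_pdf m C z)%:E)%E.
Proof.
pose nu : {measure set (R * R) -> \bar R} := bivariate_normal m C.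
pose mu : {measure set (measurableTypeR R * measurableTypeR R) -> \bar R} :=
  (lebesgue_measure \x lebesgue_measure)%E.
move=> mg; apply: (@integral_density _ _ _ _ R mu nu id (bivariate_normal_pdf m C)) => //.
- by move=> z; exact: bivariate_normal_pdf_ge0.
- exact: measurable_bivariate_normal_pdf.
Qed.

Theorem theorem3 (R : realType) (beta alpha1 alpha2 : R) (N1 N2 : nat -> nat)
    (A B : forall N : nat, {set 'I_N})
    (beta_ge0 : 0 <= beta) (beta_lt1 : beta < 1)
    (N1_gt0 : forall N : nat, (2 <= N)%N -> (0 < N1 N)%N)
    (N2_gt0 : forall N : nat, (2 <= N)%N -> (0 < N2 N)%N)
    (N12_le : forall N : nat, (2 <= N)%N -> (N1 N + N2 N <= N)%N)
    (N1_infty : N1 N @[N --> \oo] --> \oo)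
    (N2_infty : N2 N @[N --> \oo] --> \oo)
    (alpha1_lim : (N1 N)%:R / N%:R @[N --> \oo] --> alpha1)
    (alpha2_lim : (N2 N)%:R / N%:R @[N --> \oo] --> alpha2)
    (card_A : forall N : nat, (2 <= N)%N -> #|A N| = N1 N)
    (card_B : forall N : nat, (2 <= N)%N -> #|B N| = N2 N)
    (disjoint_AB : forall N : nat, (2 <= N)%N -> [disjoint A N & B N]%B) :
  cvg_in_distribution (fun N => curie_weiss N beta)
    (fun N => normalized_sums (A N) (B N))
    (bivariate_normal (0, 0)
       (mx2 (1 + alpha1 * (beta / (1 - beta)))
            (Num.sqrt (alpha1 * alpha2) * (beta / (1 - beta)))
            (Num.sqrt (alpha1 * alpha2) * (beta / (1 - beta)))
            (1 + alpha2 * (beta / (1 - beta))))).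
Proof.
rewrite -/(limit_cov beta alpha1 alpha2) => f cf bf.
have [a1 a2] := @alpha_ge0 R alpha1 alpha2 N1 N2 alpha1_lim alpha2_lim.
have nm_le : \forall N \near \oo, (N1 N + N2 N <= N)%N.
  by exists 2%N => // N; exact: N12_le.
pose mu2 := (@lebesgue_measure R \x @lebesgue_measure R)%E.
pose H := limit_density beta alpha1 alpha2.
pose S g N := spin_sum beta N (N1 N) (N2 N) g.
(* Applied to [f] and to the constant [1], this gives the limits of numerator and denominator. *)
have lim g : continuous g -> bounded_fun g -> exists J : R,
    [/\ mu2.-integrable [set: R * R] (EFin \o (fun z => H z * g z)),
        S g N @[N --> \oo] --> J & (\int[mu2]_z (H z * g z)%:E = J%:E)%E].
  move=> cg bg.
  have [iH cS] := @spin_sum_cvg R beta alpha1 alpha2 N1 N2 beta_ge0 beta_lt1 nm_le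
    N1_infty N2_infty alpha1_lim alpha2_lim g cg bg.
  have JE := fineK (integrable_fin_num measurableT iH).
  exists (fine (\int[mu2]_z (H z * g z)%:E)); split => //.
  suff /fine_cvgP[] : (S g N)%:E @[N --> \oo] --> (fine (\int[mu2]_z (H z * g z)%:E))%:E by [].
  by rewrite [X in _ --> X]JE.
have mf : measurable_fun [set: R * R] f by exact: continuous_measurable_fun2.
have [J [iJ SJ JE]] := lim f cf bf.
have [||J1 [iJ1 SJ1 J1E]] := lim (cst 1).
- by move=> z; exact: cvg_cst.
- exact: bounded_cst.
have [c c0 pdfE] := bivariate_normal_pdf_limit beta_ge0 beta_lt1 a1 a2.
have nE g K : measurable_fun [set: R * R] g ->
    mu2.-integrable [set: R * R] (EFin \o (fun z => H z * g z)) ->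
    (\int[mu2]_z (H z * g z)%:E = K%:E)%E ->
    (\int[bivariate_normal (0, 0)%R (limit_cov beta alpha1 alpha2)]_z (g z)%:E =
     (c * K)%:E)%E.
  move=> mg iH KE.
  rewrite integral_bivariate_normal//.
  rewrite EFinM -KE -integralZl//; apply: eq_integral => z _.
  by rewrite pdfE -EFinM; congr EFin; rewrite /H; ring.
(* The normal law has mass [1]; this identifies [c] as [1 / J1] and shows that the denominators have
   a nonzero limit. *)
have cJ1 : c * J1 = 1.
  apply: EFin_inj; rewrite -(nE (cst 1) J1)//.
  rewrite (eq_integral (cst 1%E))//.
  by rewrite integral_cst// mul1e; exact: bivariate_normal_limit_setT.
have J10 : J1 != 0.
  by apply/eqP => J10; move/eqP: cJ1; rewrite J10 mulr0 eq_sym oner_eq0.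
rewrite (nE f J mf iJ JE).
have h : S f N / S (cst 1) N @[N --> \oo] --> c * J.
  rewrite (_ : c * J = J / J1); first by apply: cvgM => //; exact: cvgV.
  by apply: (mulIf J10); rewrite divfK// mulrAC cJ1 mul1r.
have hE : (S f N / S (cst 1) N)%:E @[N --> \oo] --> (c * J)%:E.
  by apply: cvg_EFin => //; exact: nearW.
apply: cvg_trans hE; apply: near_eq_cvg; near=> N.
(* Two disjoint nonempty groups exist only from [N = 2] on, where the hypotheses start. *)
have N2' : (2 <= N)%N by near: N; exact: nbhs_infty_ge.
rewrite integral_distribution_spins ?card_A ?card_B ?N1_gt0 ?N2_gt0 ?disjoint_AB//.
Unshelve. all: by end_near. Qed.
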